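(* Let $f:\mathbb{R}^d\to\mathbb{R}$ be $L$-smooth ($\|\nabla f(x)-\nabla f(y)\|\le L\|x-y\|$) and $\mu$-strongly convex ($f(x)-f(y)-\langle\nabla f(y),x-y\rangle\ge\frac\mu2\|x-y\|^2$), with minimizer $x^*$, where $f(x)=\mathbb{E}_{Z\sim\pi}[F(x,Z)]$. Assume $\{Z_i\}_{i\ge0}$ is a stationary Markov chain with kernel $\mathrm{Q}$, unique invariant distribution $\pi$ and $\sup_{z,z'}\frac12\|\mathrm{Q}^k(z,\cdot)-\mathrm{Q}^k(z',\cdot)\|_{\mathsf{TV}}\le(1/4)^{\lfloor k/\tau\rfloor}$ for all $k\in\mathbb{N}$, and that $\mathbb{E}_\pi[\nabla F(x,Z)]=\nabla f(x)$ and $\|\nabla F(x,z)-\nabla f(x)\|^2\le\sigma^2+\delta^2\|\nabla f(x)\|^2$ for all $x,z$. Run Randomized Accelerated GD (see context) for $N$ iterations with any $b\in\mathbb{N}^*$, $\gamma\in(0,\frac{3}{4L}]$ and $$p=\Big[1+2(1+\gamma L)\Big(1+4\big[C_1\tau b^{-1}+(C_1+1)\tau^2b^{-2}\big]\delta^2\Big)\Big]^{-1},\quad \beta=\sqrt{\tfrac{4p^2\mu\gamma}{3}},\quad \eta=\sqrt{\tfrac{3}{\mu\gamma}},$$ $$\theta=\frac{p\eta^{-1}-1}{\beta p\eta^{-1}-1},\quad M=\max\Big\{2;\sqrt{C_2p^{-1}(1+2p/\beta)}\Big\},\quad B=\lceil b\log_2M\rceil,$$ where $C_1=16(1+1/\ln^24)$,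 $C_2=256/3$. Then there is an absolute constant $C>0$ such that $$\mathbb{E}\Big[\|x^N-x^*\|^2+\tfrac6\mu\big(f(x^N_f)-f(x^* )\big)\Big]\le C\Big\{\exp\Big(-N\sqrt{\tfrac{p^2\mu\gamma}{3}}\Big)\Big[\|x^0-x^*\|^2+\tfrac6\mu\big(f(x^0)-f(x^* )\big)\Big]+\frac{p\sqrt\gamma}{\mu^{3/2}}\big(\sigma^2\tau b^{-1}+\sigma^2\tau^2b^{-2}\big)\Big\}.$$
   Context: Randomized Accelerated GD: parameters $\gamma,\theta,\eta,\beta,p$, iterations $N$, batch limit $M$, base batch $B$; initialization $x^0=x^0_f$, $T^0=0$. For $k=0,\dots,N-1$: $x^k_g=\theta x^k_f+(1-\theta)x^k$; sample $J_k\sim\mathrm{Geom}(1/2)$ ($\mathbb{P}(J_k=j)=2^{-j}$, $j\ge1$); $g^k_j=2^{-j}B^{-1}\sum_{i=1}^{2^jB}\nabla F(x^k_g,Z_{T^k+i})$; $g^k=g^k_0+2^{J_k}(g^k_{J_k}-g^k_{J_k-1})$ if $2^{J_k}\le M$, else $g^k=g^k_0$; $x^{k+1}_f=x^k_g-p\gamma g^k$; $x^{k+1}=\eta x^{k+1}_f+(p-\eta)x^k_f+(1-p)(1-\beta)x^k+(1-p)\beta x^k_g$; $T^{k+1}=T^k+2^{J_k}B$. $\|\cdot\|_{\mathsf{TV}}$ is the total variation norm; $\tau\in\mathbb{N}$ is the mixing time; $\sigma,\delta\ge0$. *)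

(* Defs.v *)
From HB Require Import structures.
From mathcomp Require Import all_boot all_order all_algebra.
From mathcomp Require Import all_classical all_reals all_analysis.
Set Implicit Arguments. Unset Strict Implicit. Unset Printing Implicit Defensive.
Import Order.TTheory GRing.Theory Num.Theory.
Import numFieldNormedType.Exports.
Local Open Scope classical_set_scope.
Local Open Scope ring_scope.

(** Vectors of R^d are row vectors 'rV[R]_d, with the Euclidean inner
    product and norm (the library's matrix norm is the sup-norm). *)
Definition dotv {R : realType} {d : nat} (u v : 'rV[R]_d) : R :=
  \sum_(i < d) u ord0 i * v ord0 i.
Definition enorm {R : realType} {d : nat} (u : 'rV[R]_d) : R :=
  Num.sqrt (dotv u u).

Definition is_gradient {R : realType} {d : nat} (f : 'rV[R]_d -> R)
  (g : 'rV[R]_d) (x : 'rV[R]_d) : Prop :=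
  differentiable f x /\ forall h, 'd f x h = dotv g h.

Fixpoint Qpow {R : realType} {dz} {Z : measurableType dz}
  (Q : R.-pker Z ~> Z) (k : nat) (z : Z) (A : set Z) : \bar R :=
  match k with
  | 0%N => (\1_A z)%:E
  | k'.+1 => (\int[Q z]_y Qpow Q k' y A)%E
  end.

(** (1/2) || mu - nu ||_TV  <= eps, with
    (1/2)||mu - nu||_TV = sup_{A measurable} |mu(A) - nu(A)|
    for probability measures mu, nu. *)
Definition half_tv_le {R : realType} {dz} {Z : measurableType dz}
  (mu nu : set Z -> \bar R) (eps : R) : Prop :=
  forall A, measurable A -> `| fine (mu A) - fine (nu A) | <= eps.

Definition kernel_invariant {R : realType} {dz} {Z : measurableType dz}
  (Q : R.-pker Z ~> Z) (nu : probability Z R) : Prop :=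
  forall A, measurable A -> (\int[nu]_z Q z A)%E = nu A.

Fixpoint path_prob {R : realType} {dz} {Z : measurableType dz}
  (Q : R.-pker Z ~> Z) (As : seq (set Z)) (z : Z) : \bar R :=
  match As with
  | [::] => 1%E
  | A :: As' => ((\1_A z)%:E * \int[Q z]_y path_prob Q As' y)%E
  end.

Definition geom_half {R : realType} (j : nat) : R :=
  if j == 0%N then 0 else (2 ^- j).

(** One iteration of Randomized Accelerated GD.
    State = (x^k, x_f^k, T^k). Zs is the (realized) sample sequence
    Z_0, Z_1, ..., and j the realized value of J_k. *)
Section RAGD.
Variables (R : realType) (d : nat) (Zt : Type).
Variables (gamma theta eta beta p M : R) (B : nat).
Variable gradF : 'rV[R]_d -> Zt -> 'rV[R]_d.

Definition mlmc_level (Zs : nat -> Zt) (T : nat) (xg : 'rV[R]_d) (j : nat)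
  : 'rV[R]_d :=
  ((2 ^- j) / B%:R) *: \sum_(i < (2 ^ j * B)%N) gradF xg (Zs (T + i.+1)%N).

Definition mlmc_grad (Zs : nat -> Zt) (T : nat) (xg : 'rV[R]_d) (j : nat)
  : 'rV[R]_d :=
  if (2 ^ j)%N%:R <= M then
    mlmc_level Zs T xg 0 + (2 ^ j)%N%:R *: (mlmc_level Zs T xg j - mlmc_level Zs T xg j.-1)
  else mlmc_level Zs T xg 0.

Definition ragd_step (Zs : nat -> Zt) (j : nat)
  (s : 'rV[R]_d * 'rV[R]_d * nat) : 'rV[R]_d * 'rV[R]_d * nat :=
  let: (x, xf, T) := s in
  let xg := theta *: xf + (1 - theta) *: x in
  let g := mlmc_grad Zs T xg j in
  let xf' := xg - (p * gamma) *: g in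
  let x' := eta *: xf' + (p - eta) *: xf + ((1 - p) * (1 - beta)) *: x
            + ((1 - p) * beta) *: xg in
  (x', xf', (T + 2 ^ j * B)%N).

Fixpoint ragd (Zs : nat -> Zt) (Js : nat -> nat) (x0 : 'rV[R]_d) (k : nat)
  : 'rV[R]_d * 'rV[R]_d * nat :=
  match k with
  | 0%N => (x0, x0, 0%N)
  | k'.+1 => ragd_step Zs (Js k') (ragd Zs Js x0 k')
  end.
End RAGD.

(* Main.v *)
(** With [Psi^k = ||x^k - xs||^2 + (6/mu) (f(x_f^k) - f(xs))], [xs] the
    minimizer, strong convexity and smoothness bound [Psi^{k+1}] pointwise by
    [(1 - beta/2) Psi^k], a negative multiple of [||grad f(x_g^k)||^2], a term
    linear in the gradient error and one quadratic in it. Given the past and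
    [J_k = j], the error is an average of [grad F - grad f] along the next [2^j
    B] states of the chain. Mixing bounds correlations at distance [m] by
    [4^{-floor(m/tau)}], so an average over [n] states has mean of order [tau/n]
    and variance of order [tau/n]. Averaging over [J_k], the linear part
    telescopes to the top level [l], where [2^l] is of order [M], so the bias is
    of order [tau/(M B)]; each of the [l] levels adds [O(tau/B)] to the second
    moment, and [B >= b l] makes this [O(tau/b)]. The choices of [p] and [M] let
    the negative gradient term and the [beta/2] slack absorb everything except a
    multiple of [sigma^2], and the recursion [E Psi^{k+1} <= (1 - beta/2) E
    Psi^k + T] is summed, with [(1 - beta/2)^N <= exp(-N beta/2)] and [beta/2 =
    sqrt(p^2 mu gamma/3)]. All random variables are bounded once the [J_k] are
    prescribed, so integrability is never an issue; measurability of the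
    gradients in [(x, z)] comes from the continuity of [F(., z)] and [f]. *)

Require Import Defs.
From HB Require Import structures.
From mathcomp Require Import all_boot all_order all_algebra.
From mathcomp Require Import all_classical all_reals all_analysis.
From mathcomp Require Import measurable_realfun.
From mathcomp Require Import ring lra.
Set Implicit Arguments. Unset Strict Implicit. Unset Printing Implicit Defensive.
Import Order.TTheory GRing.Theory Num.Theory.
Import numFieldNormedType.Exports.
Local Open Scope classical_set_scope.
Local Open Scope ring_scope.

(** * Kernels *)

(** The joint law of states and levels is known only through its values on cylinders, [law].
    Conditional expectations are therefore replaced by uniqueness of measures on pi-systems: the
    Markov property becomes an identity between integrals over pairs of past and later state
    ([markov_integral]), and independence of the levels one over events prescribing the [J k]
    ([independence_past]). The time at which a step starts is random, so the past at that time is no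
    fixed sigma-algebra. With a prescribed prefix of levels it is fixed; the run is recovered by
    induction on the number of steps still to come, splitting on the next level. This split is a
    series, so one-step bounds are stated for partial sums over the levels. The numerical constants
    fit tightly: [14 * 19 / 3 <= 16 * (111 / 20)] for the variance,
    [(8 / 3) ^+ 2 * (3 / 64) / 17 = 1 / 51] for the bias, and these leave the squared gradient norm
    a negative coefficient. *)

Section disintegration.
Local Open Scope ereal_scope.

Lemma integral_mrestr d (T : measurableType d) (R : realType)
    (mu : {measure set T -> \bar R}) (D : set T) (mD : measurable D)
    (f : T -> \bar R) : measurable_fun setT f -> (forall x, 0 <= f x) ->
  \int[mrestr mu mD]_x f x = \int[mu]_(x in D) f x.
Proof.
move=> mf f0.
rewrite -(setUv D) ge0_integral_setU//=.
- rewrite [X in _ + X]null_set_integral//=.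
  + rewrite adde0; apply: eq_measure_integral => A mA AD /=.
    by rewrite /mrestr; congr (mu _); apply/setIidPl.
  + exact: measurableC.
  + exact: measurable_funS mf.
  + by rewrite /mrestr setICl measure0.
- exact: measurableC.
- by rewrite setUv.
- by apply/disj_setPS => x [].
Qed.

Definition pushmeas d d' (T : measurableType d) (T' : measurableType d')
    (R : realType) (mu : {measure set T -> \bar R}) (f : T -> T')
    (mf : measurable_fun setT f) : {measure set T' -> \bar R} :=
  measure_function_pushforward__canonical__measure_function_Measure mu mf.

Lemma integral_pushmeas d d' (T : measurableType d) (T' : measurableType d')
    (R : realType) (mu : {measure set T -> \bar R}) (f : T -> T')
    (mf : measurable_fun setT f) (g : T' -> \bar R) :
  measurable_fun setT g -> (forall y, 0 <= g y) ->
  \int[pushmeas mu mf]_y g y = \int[mu]_x g (f x).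
Proof.
move=> mg g0; have := ge0_integral_pushforward mf mu measurableT mg (fun y _ => g0 y).
by rewrite preimage_setT.
Qed.

Section fpush.
Context d d' (T : measurableType d) (T' : measurableType d') (R : realType)
  (nu : {finite_measure set T -> \bar R}) (f : T -> T').

(** A second name for [pushmeas], under which finiteness is recorded; [mixture] asks for a finite
    base measure. *)
Definition fpush (mf : measurable_fun setT f) : set T' -> \bar R :=
  pushmeas nu mf.
Hypothesis mf : measurable_fun setT f.

HB.instance Definition _ := Measure.on (fpush mf).

Let fpush_fin : fin_num_fun (fpush mf).
Proof.
move=> A mA; apply: fin_num_measure.
by rewrite -[X in measurable X]setTI; exact: mf.
Qed.

HB.instance Definition _ := Measure_isFinite.Build _ _ _ (fpush mf) fpush_fin.
End fpush.

Section const_kernel.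
Context d d' (X : measurableType d) (Y : measurableType d') (R : realType)
  (nu : {finite_measure set Y -> \bar R}).

Definition const_kernel (_ : X) : {measure set Y -> \bar R} := nu.

Let const_kernel_meas (U : set Y) : measurable U ->
  measurable_fun [set: X] (const_kernel ^~ U).
Proof. by move=> mU; exact: measurable_cst. Qed.

HB.instance Definition _ :=
  isKernel.Build _ _ X Y R const_kernel const_kernel_meas.

Let const_kernel_uub : measure_fam_uub const_kernel.
Proof.
exists (fine (nu setT) + 1)%R => x; rewrite /const_kernel EFinD fineK ?fin_num_measure//.
by rewrite lteDl ?fin_num_measure// lte01.
Qed.

HB.instance Definition _ := Kernel_isFinite.Build _ _ X Y R const_kernel const_kernel_uub.
End const_kernel.

Section kernel_precomp.
Context d d' d'' (X : measurableType d) (Y : measurableType d')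
  (Z : measurableType d'') (R : realType) (g : X -> Y) (K : R.-spker Y ~> Z).

Definition kernel_precomp (mg : measurable_fun setT g) (x : X) :
  {measure set Z -> \bar R} := K (g x).
Hypothesis mg : measurable_fun setT g.

Let kernel_precomp_meas (U : set Z) : measurable U ->
  measurable_fun [set: X] (kernel_precomp mg ^~ U).
Proof.
move=> mU; exact: (measurableT_comp (measurable_kernel K U mU) mg).
Qed.

HB.instance Definition _ :=
  isKernel.Build _ _ X Z R (kernel_precomp mg) kernel_precomp_meas.

Let kernel_precomp_uub : measure_fam_uub (kernel_precomp mg).
Proof.
(* [measure_fam_uub] asks for a strict bound, so the mass bound 1 is raised to 2. *)
exists 2%R => x; apply: (@le_lt_trans _ _ 1); last by rewrite lte_fin ltr1n.
exact: sprob_kernel_le1.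
Qed.

HB.instance Definition _ :=
  Kernel_isFinite.Build _ _ X Z R (kernel_precomp mg) kernel_precomp_uub.
End kernel_precomp.

Section graph_kernel.
Context d d' (X : measurableType d) (Z : measurableType d') (R : realType)
  (K : R.-fker X ~> Z).

(** Kernel form of $\delta_x\otimes K(x)$. Mixed over the law of the past, it becomes the joint law
    of the past and a later state. *)
Definition graph_kernel (x : X) : {measure set (X * Z) -> \bar R} :=
  pushmeas (K x) (pair1_measurable x).

Let graph_kernelE (U : set (X * Z)) x : graph_kernel x U = K x (xsection U x).
Proof.
by rewrite xsectionE.
Qed.

Let graph_kernel_meas (U : set (X * Z)) : measurable U ->
  measurable_fun [set: X] (graph_kernel ^~ U).
Proof.
move=> mU; apply: (eq_measurable_fun (fun x => K x (xsection U x))).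
  by move=> x _; rewrite graph_kernelE.
by apply: measurable_fun_xsection_finite_kernel; rewrite inE.
Qed.

HB.instance Definition _ :=
  isKernel.Build _ _ X (X * Z)%type R graph_kernel graph_kernel_meas.

Let graph_kernel_uub : measure_fam_uub graph_kernel.
Proof.
have [r Kr] := measure_uub K; exists r => x; rewrite graph_kernelE.
by apply: (le_lt_trans _ (Kr x)); apply: le_measure; rewrite ?inE//; exact: measurable_xsection.
Qed.

HB.instance Definition _ :=
  Kernel_isFinite.Build _ _ X (X * Z)%type R graph_kernel graph_kernel_uub.
End graph_kernel.

Section integral_mixture.
Context d d' (Y : measurableType d) (Z : measurableType d') (R : realType)
  (nu : {finite_measure set Y -> \bar R}) (K : R.-fker Y ~> Z).

(** [kcomp] composes a kernel on [X] with one on [X * Y]; with [X = unit], its integration formula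
    specializes to mixtures over a single measure. *)
Definition snd_kernel : unit * Y -> {measure set Z -> \bar R} :=
  fun x => K x.2.

Let snd_kernel_meas (U : set Z) : measurable U ->
  measurable_fun [set: unit * Y] (snd_kernel ^~ U).
Proof.
move=> mU; exact: (measurableT_comp (measurable_kernel K U mU) measurable_snd).
Qed.

HB.instance Definition _ :=
  isKernel.Build _ _ _ Z R snd_kernel snd_kernel_meas.

Let snd_kernel_uub : measure_fam_uub snd_kernel.
Proof. by have [r Kr] := measure_uub K; exists r => x; exact: Kr. Qed.

HB.instance Definition _ :=
  Kernel_isFinite.Build _ _ _ Z R snd_kernel snd_kernel_uub.

Definition mixture : set Z -> \bar R := kcomp (const_kernel nu) snd_kernel tt.

HB.instance Definition _ := Measure.on mixture.

Lemma mixtureE U : mixture U = \int[nu]_y K y U.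
Proof. by []. Qed.

Lemma integral_mixture f : measurable_fun [set: Z] f -> (forall z, 0 <= f z) ->
  \int[mixture]_z f z = \int[nu]_y \int[K y]_z f z.
Proof. by move=> mf f0; exact: (integral_kcomp (const_kernel nu) snd_kernel). Qed.

Let mixture_fin : fin_num_fun mixture.
Proof.
suff : mixture setT < +oo by exact: lty_fin_num_fun.
rewrite mixtureE.
have [r Kr] := measure_uub K.
apply: (@le_lt_trans _ _ (\int[nu]__ (Num.max r 0)%:E)).
  apply: ge0_le_integral => //.
  - exact: measurable_kernel.
  - by move=> y _; rewrite (le_trans (ltW (Kr y)))// lee_fin le_max lexx.
by rewrite integral_cst//= ltey_eq fin_numM// fin_num_measure.
Qed.

HB.instance Definition _ := Measure_isFinite.Build _ _ _ mixture mixture_fin.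

End integral_mixture.

End disintegration.

(** * The Markov chain and its mixing *)

Section chain.
Local Open Scope ereal_scope.
Context (R : realType) dz (Zsp : measurableType dz) (Q : R.-pker Zsp ~> Zsp).

(** [Qpow] is a bare set function; the same recursion in bundled kernels makes it possible to
    integrate against it. *)
Fixpoint Qiter (k : nat) : R.-spker Zsp ~> Zsp :=
  match k with
  | 0%N => kdirac (@measurable_id _ Zsp setT)
  | k'.+1 => mkcomp_noparam Q (Qiter k')
  end.

Lemma QiterE k z A : Qiter k z A = Qpow Q k z A.
Proof.
elim: k z => [//|k IH] z /=.
by apply: eq_integral => y _; exact: IH.
Qed.

Lemma Qpow_setT k z : Qpow Q k z setT = 1.
Proof.
elim: k z => [z|k IH z] /=; first by rewrite indicT.
by under eq_integral do rewrite IH; rewrite integral_cst// mul1e prob_kernel.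
Qed.

Lemma measurable_Qpow k A : measurable A ->
  measurable_fun setT (fun z => Qpow Q k z A).
Proof.
move=> mA; have := measurable_kernel (Qiter k) A mA.
by apply: eq_measurable_fun => z _; rewrite QiterE.
Qed.

(** [path_prob] with a terminal weight [phi] in place of 1. It serves to cut a path at a given time,
    as in [path_prob_cat]. *)
Fixpoint path_int (As : seq (set Zsp)) (phi : Zsp -> \bar R) (z : Zsp) : \bar R :=
  match As with
  | [::] => phi z
  | A :: As' => (\1_A z)%:E * \int[Q z]_y path_int As' phi y
  end.

Lemma path_prob_cat As Bs z : path_prob Q (As ++ Bs) z = path_int As (path_prob Q Bs) z.
Proof.
elim: As z => [//|A As IH] z /=; congr (_ * _).
by apply: eq_integral => y _; exact: IH.
Qed.

Lemma path_prob1 A z : path_prob Q [:: A] z = (\1_A z)%:E.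
Proof. by rewrite /= integral_cst// mul1e prob_kernel mule1. Qed.

Lemma path_prob_nseq k A B z :
  path_prob Q (A :: nseq k setT ++ [:: B]) z = (\1_A z)%:E * Qpow Q k.+1 z B.
Proof.
elim: k A z => [|k IH] A z.
  by rewrite /= ; congr (_ * _); apply: eq_integral => y _; exact: path_prob1.
rewrite /= ; congr (_ * _); apply: eq_integral => y _.
by move: (IH setT y) => /=; rewrite indicT !mul1e.
Qed.

Lemma path_int_ge0 As phi z : (forall z, 0 <= phi z) -> 0 <= path_int As phi z.
Proof.
move=> phi0; elim: As z => [//|A As IH] z /=.
by rewrite mule_ge0// ?lee_fin//; exact: integral_ge0.
Qed.

Lemma measurable_path_int As phi : {in As, forall A, measurable A} ->
  (forall z, 0 <= phi z) -> measurable_fun setT phi ->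
  measurable_fun setT (path_int As phi).
Proof.
move=> mAs phi0 mphi; elim: As mAs => [//|A As IH] mAs /=.
apply: emeasurable_funM.
  by apply/measurable_EFinP; apply: measurable_indic; apply: mAs; rewrite mem_head.
apply: measurable_fun_integral_kernel.
- by move=> U mU; exact: measurable_kernel.
- by move=> z; exact: path_int_ge0.
- by apply: IH => B BAs; apply: mAs; rewrite in_cons BAs orbT.
Qed.

(** Each set of [As] restricts the current measure and each step of [Q] mixes it, so the functional
    of [phi] is integration against a finite measure. Identities in [phi] can then be tested on
    indicators. *)
Lemma path_int_measure As (nu : {finite_measure set Zsp -> \bar R}) :
  {in As, forall A, measurable A} ->
  exists nu' : {finite_measure set Zsp -> \bar R},
    forall phi, (forall z, 0 <= phi z) -> measurable_fun setT phi ->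
      \int[nu]_z path_int As phi z = \int[nu']_z phi z.
Proof.
elim: As nu => [|A As IH] nu mAs; first by exists nu.
have mA : measurable A by apply: mAs; rewrite mem_head.
have mAs' : {in As, forall A, measurable A}.
  by move=> B BAs; apply: mAs; rewrite in_cons BAs orbT.
have [nu' nu'E] := IH (mixture (mrestr nu mA) Q) mAs'.
exists nu' => phi phi0 mphi; rewrite -nu'E//.
have mphi' := measurable_path_int mAs' phi0 mphi.
have phi'0 z : 0 <= path_int As phi z by exact: path_int_ge0.
rewrite [RHS](integral_mixture (mrestr nu mA) Q)//= integral_mrestr//.
- by rewrite integral_mkcond; apply: eq_integral => z _; rewrite epatch_indic muleC.
- exact: measurable_fun_integral_kernel (fun U mU => measurable_kernel Q U mU) _ phi'0 mphi'.
- by move=> z; exact: integral_ge0.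
Qed.

End chain.

(** The sum is [h] times the number of grid points [h, 2h, ..., m h] that do not exceed [u]: the
    staircase behind the layer-cake argument of [tv_integral_le]. *)
Lemma sum_steps (R : realType) (h u : R) (m : nat) : 0 <= h ->
  0 <= u -> let s := \sum_(k < m) h * (k.+1%:R * h <= u)%R%:R in
  s <= u /\ Num.min u (m%:R * h) <= s + h.
Proof.
move=> h0 u0 /=.
have full k : k%:R * h <= u -> \sum_(i < k) h * (i.+1%:R * h <= u)%R%:R = k%:R * h.
  move=> ku; rewrite (eq_bigr (fun=> h)) ?sumr_const ?card_ord ?mulr_natl// => i _.
  by rewrite (le_trans _ ku) ?mulr1// ler_wpM2r// ler_nat.
elim: m => [|m [IH1 IH2]].
  by rewrite big_ord0 mul0r add0r ge_min h0 orbT.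
have [mu|mu] := leP (m.+1%:R * h) u.
  by rewrite full//; split => //; rewrite lerDl.
rewrite big_ord_recr/= [(_ <= u)%R]leNgt mu/= mulr0 addr0; split => //.
move: IH2; have [//|um _] := leP u (m%:R * h).
rewrite (full _ (ltW um)); apply: (le_trans (ltW mu)).
by rewrite -natr1 mulrDl mul1r.
Qed.

(** * From total variation of measures to differences of integrals *)

Section total_variation.
Local Open Scope ereal_scope.
Context d (Y : measurableType d) (R : realType).

(* Layer-cake: [u] is within [a / n] of an average of [n] multiples of
   indicators of superlevel sets, on each of which the measures differ by at
   most [eps]. *)
Lemma tv_integral_le (mu nu : {measure set Y -> \bar R}) (eps a : R) (u : Y -> R) :
  mu setT = 1 -> nu setT = 1 -> half_tv_le mu nu eps -> (0 <= eps)%R ->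
  measurable_fun setT u -> (forall y, 0 <= u y <= a)%R ->
  \int[mu]_y (u y)%:E <= \int[nu]_y (u y)%:E + (a * eps)%:E.
Proof.
move=> mu1 nu1 tv eps0 mu_ ua.
have a0 : (0 <= a)%R by have /andP[u0 /(le_trans u0)] := ua point.
have fin (m : {measure set Y -> \bar R}) A : m setT = 1 -> measurable A -> m A \is a fin_num.
  move=> m1 mA; rewrite ge0_fin_numE//; apply: (@le_lt_trans _ _ (m setT)).
    by apply: le_measure; rewrite ?inE.
  by rewrite m1 ltry.
apply/lee_addgt0Pr => e e0.
(* The steps have height [h <= e], while all [n.+1] of them together cover the range [[0, a]]. *)
pose n := Num.truncn (a / e)%R; pose h := (a / n.+1%:R)%R.
have h0 : (0 <= h)%R by rewrite divr_ge0.
have he : (h <= e)%R.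
  rewrite ler_pdivrMr// mulrC -ler_pdivrMr// ltW//.
  by have /andP[] := truncn_itv (divr_ge0 a0 (ltW e0)).
pose A (k : 'I_n.+1) := [set y | k.+1%:R * h <= u y]%R.
have mA k : measurable (A k).
  by rewrite -[A k]setTI; exact: measurable_fun_le.
pose s y := (\sum_(k < n.+1) h * \1_(A k) y)%R.
have sE y : s y = (\sum_(k < n.+1) h * (k.+1%:R * h <= u y)%R%:R)%R.
  by apply: eq_bigr => k _; rewrite indicE mem_setE.
have ms : measurable_fun setT s.
  by apply: measurable_sum => k; apply: measurable_funM => //; exact: measurable_indic.
have s0 y : (0 <= s y)%R by apply: sumr_ge0 => k _; rewrite mulr_ge0.
have us y : (s y <= u y)%R /\ (u y <= s y + h)%R.
  have /andP[uy0 uya] := ua y.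
  have [su us] := sum_steps n.+1 h0 uy0; rewrite sE; split => //.
  by move: us; rewrite mulrC divfK// (min_idPl uya).
have is_ (m : {measure set Y -> \bar R}) : \int[m]_y (s y)%:E = \sum_(k < n.+1) h%:E * m (A k).
  under eq_integral do rewrite /s -sumEFin.
  rewrite ge0_integral_sum//; last 2 first.
  - by move=> k; apply/measurable_EFinP; apply: measurable_funM => //; exact: measurable_indic.
  - by move=> k y _; rewrite lee_fin mulr_ge0.
  apply: eq_bigr => k _; under eq_integral do rewrite EFinM.
  rewrite ge0_integralZl//; last by apply/measurable_EFinP; exact: measurable_indic.
  by rewrite integral_indic// setIT.
apply: (@le_trans _ _ (\int[mu]_y (s y + h)%:E)).
  apply: ge0_le_integral => //.
  - by move=> y _; rewrite lee_fin; case/andP: (ua y).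
  - exact/measurable_EFinP.
  - by apply/measurable_EFinP; exact: measurable_funD.
  - by move=> y _; rewrite lee_fin; case: (us y).
under eq_integral do rewrite EFinD.
rewrite ge0_integralD//; last 2 first.
- by move=> y _; rewrite lee_fin.
- exact/measurable_EFinP.
rewrite integral_cst// mu1 mule1.
apply: leeD; last by rewrite lee_fin.
apply: (@le_trans _ _ (\int[nu]_y (s y)%:E + (a * eps)%:E)); last first.
  rewrite leeD2r//; apply: ge0_le_integral => //.
  - by move=> y _; rewrite lee_fin.
  - exact/measurable_EFinP.
  - exact/measurable_EFinP.
  - by move=> y _; rewrite lee_fin; case: (us y).
rewrite !is_.
have -> : (a * eps)%:E = \sum_(k < n.+1) (h * eps)%:E.
  rewrite sumEFin; congr EFin.
  by rewrite sumr_const card_ord -mulr_natl mulrA [(_ * h)%R]mulrC divfK.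
rewrite -big_split/=; apply: lee_sum => k _.
rewrite -(fineK (fin mu (A k) mu1 (mA k))) -(fineK (fin nu (A k) nu1 (mA k))).
rewrite -!EFinM -EFinD lee_fin -mulrDr ler_wpM2l//.
by have := tv _ (mA k); rewrite ler_norml => /andP[_]; rewrite lerBlDl.
Qed.

End total_variation.

Lemma integral_cst_prob d (T : measurableType d) (R : realType)
    (P : probability T R) (r : R) : (\int[P]__ r%:E = r%:E)%E.
Proof.
rewrite integral_cst// -[RHS]mule1; congr (_ * _)%E.
exact: (probability_setT P).
Qed.

Section mixing.
Local Open Scope ereal_scope.
Context (R : realType) dz (Zsp : measurableType dz) (Q : R.-pker Zsp ~> Zsp)
  (pi : probability Zsp R) (tau : nat).
Hypothesis piQ : kernel_invariant Q pi.
Hypothesis mix : forall (k : nat) (z z' : Zsp),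
  half_tv_le (Qpow Q k z) (Qpow Q k z') ((4^-1) ^+ (k %/ tau)).

Lemma invariant_Qpow k A : measurable A -> \int[pi]_z Qpow Q k z A = pi A.
Proof.
move=> mA; elim: k => [|k IH] /=; first by rewrite integral_indic// setIT.
rewrite -[RHS]IH -(integral_mixture pi Q).
- apply: eq_measure_integral => B mB _; exact: piQ.
- exact: measurable_Qpow.
- by move=> z; rewrite -QiterE.
Qed.

(** Averaging over a second starting point [z'] under [pi] turns [Qpow Q k z' A] into [pi A] by
    invariance, and the pairwise bound survives the average. *)
Lemma Qiter_tv_pi k z : half_tv_le (Qiter Q k z) pi ((4^-1) ^+ (k %/ tau)).
Proof.
move=> A mA; set rho : R := (_ ^+ _)%R.
have Q01 z' : 0 <= Qpow Q k z' A <= 1.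
  rewrite -QiterE measure_ge0/= -(Qpow_setT Q k z') -!QiterE.
  by apply: le_measure; rewrite ?inE.
pose q z' := fine (Qpow Q k z' A).
have qE z' : (q z')%:E = Qpow Q k z' A.
  by rewrite fineK// ge0_fin_numE; case/andP: (Q01 z') => // _ /le_lt_trans; apply; rewrite ltry.
have q0 z' : (0 <= q z')%R by rewrite -lee_fin qE; case/andP: (Q01 z').
have mq : measurable_fun setT (EFin \o q).
  by apply: (eq_measurable_fun (fun z' => Qpow Q k z' A)) => [z' _|]; [rewrite /= qE|exact: measurable_Qpow].
have piE : \int[pi]_z' (q z')%:E = pi A.
  by under eq_integral do rewrite qE; exact: invariant_Qpow.
have rho0 : (0 <= rho)%R by rewrite exprn_ge0.
have qq z' : (`|q z - q z'| <= rho)%R by exact: mix.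
have piA : pi A = (fine (pi A))%:E by rewrite fineK// fin_num_measure.
rewrite QiterE -/(q z) ler_distl; apply/andP; split.
- rewrite lerBlDr -lee_fin -piA -piE.
  apply: (@le_trans _ _ (\int[pi]_z' (q z + rho)%:E)).
    apply: ge0_le_integral => //.
    + by move=> z' _; rewrite lee_fin.
    + by move=> z' _ /=; rewrite lee_fin; have := qq z'; rewrite ler_norml => /andP[+ _]; lra.
  by rewrite integral_cst_prob.
- rewrite -lee_fin EFinD -piA -piE.
  apply: (@le_trans _ _ (\int[pi]_z' (q z)%:E)).
    by rewrite integral_cst_prob.
  apply: (@le_trans _ _ (\int[pi]_z' ((q z')%:E + rho%:E))).
    apply: ge0_le_integral => //.
    + by move=> z' _; rewrite lee_fin.
    + exact: emeasurable_funD.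
    + by move=> z' _ /=; rewrite -EFinD lee_fin; have := qq z'; rewrite ler_norml => /andP[_]; lra.
  rewrite ge0_integralD//.
    by rewrite integral_cst_prob.
  by move=> z' _; rewrite lee_fin.
Qed.

End mixing.

(** * Conditioning on the past *)

Section past.
Local Open Scope ereal_scope.
Context (R : realType) dz (Zsp : measurableType dz) dO (Omega : measurableType dO)
  (P : probability Omega R) (Q : R.-pker Zsp ~> Zsp) (pi : probability Zsp R)
  (Z : nat -> Omega -> Zsp) (J : nat -> Omega -> nat).

Definition cyl (As : seq (set Zsp)) : set Omega :=
  [set w | forall i, (i < size As)%N -> nth setT As i (Z i w)].

Definition cylJ (js : seq nat) : set Omega :=
  [set w | forall k, (k < size js)%N -> J k w = nth 0%N js k].

Definition mseq (As : seq (set Zsp)) :=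
  forall i, (i < size As)%N -> measurable (nth setT As i).

(* [past m] is [Omega] with the sigma-algebra generated by [Z_0, ..., Z_m]; it
   is generated by cylinders so that the hypothesis [law] extends to it by
   uniqueness of measures on a pi-system. *)
Definition past_gen (m : nat) : set (set Omega) :=
  [set cyl As | As in [set As | size As = m.+1 /\ mseq As]].

Definition past (m : nat) : measurableType (sigma_display (past_gen m)) :=
  g_sigma_algebraType (past_gen m).

Definition to_past (m : nat) (w : Omega) : past m := w.

Hypothesis mZ : forall i, measurable_fun setT (Z i).
Hypothesis mJ : forall k j, measurable [set w | J k w = j].
Hypothesis law : forall (As : seq (set Zsp)) (js : seq nat), mseq As ->
  P [set w | cyl As w /\ cylJ js w]
  = (\int[pi]_z path_prob Q As z) * (\prod_(j <- js) geom_half j)%:E.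

Lemma cylE As : cyl As = \big[setI/setT]_(i < size As) (Z i @^-1` nth setT As i).
Proof.
apply/seteqP; split=> [w h|w].
  by elim/big_ind : _ => //= i _; exact: h.
move=> + i iA; rewrite (bigD1 (Ordinal iA))//= => -[]; exact.
Qed.

Lemma measurable_cyl As : mseq As -> measurable (cyl As).
Proof.
move=> mAs; rewrite cylE; apply: bigsetI_measurable => i _.
by rewrite -[X in measurable X]setTI; apply: mZ => //; exact: mAs.
Qed.

Lemma cylJE js : cylJ js = \big[setI/setT]_(i < size js) [set w | J i w = nth 0%N js i].
Proof.
apply/seteqP; split=> [w h|w].
  by elim/big_ind : _ => //= i _; exact: h.
move=> + i iA; rewrite (bigD1 (Ordinal iA))//= => -[]; exact.
Qed.

Lemma measurable_cylJ js : measurable (cylJ js).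
Proof. by rewrite cylJE; apply: bigsetI_measurable => i _; exact: mJ. Qed.

Lemma cylJ0 : cylJ [::] = setT.
Proof. by apply/seteqP; split. Qed.

Lemma lawZ As : mseq As -> P (cyl As) = \int[pi]_z path_prob Q As z.
Proof.
move=> mAs; have := law [::] mAs; rewrite big_nil mule1 => <-.
by congr (P _); apply/seteqP; split => [w ?|w []].
Qed.

Lemma lawJ As js : mseq As ->
  P (cyl As `&` cylJ js) = P (cyl As) * (\prod_(j <- js) geom_half j)%:E.
Proof. by move=> mAs; rewrite lawZ// -law. Qed.

Lemma cyl_rcons As A : cyl (rcons As A) = cyl As `&` Z (size As) @^-1` A.
Proof.
apply/seteqP; split=> [w h|w [h1 h2] i]; rewrite ?size_rcons.
- split=> [i iA|].
    by have := h i; rewrite size_rcons ltnS => /(_ (ltnW iA)); rewrite nth_rcons iA.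
  by have := h (size As); rewrite size_rcons ltnS leqnn => /(_ isT); rewrite nth_rcons ltnn eqxx.
- rewrite ltnS leq_eqVlt => /predU1P[->|iA]; last by rewrite nth_rcons iA; exact: h1.
  by rewrite nth_rcons ltnn eqxx.
Qed.

Lemma cyl_cat_setT As k : cyl (As ++ nseq k setT) = cyl As.
Proof.
elim: k => [|k IH]; first by rewrite cats0.
by rewrite -addn1 nseqD catA cats1 cyl_rcons IH preimage_setT setIT.
Qed.

Lemma mseq_rcons As A : mseq As -> measurable A -> mseq (rcons As A).
Proof.
move=> mAs mA i; rewrite size_rcons ltnS leq_eqVlt => /predU1P[->|iA].
  by rewrite nth_rcons ltnn eqxx.
by rewrite nth_rcons iA; exact: mAs.
Qed.

Lemma mseq_nseq k : mseq (nseq k setT).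
Proof. by move=> i _; rewrite nth_nseq; case: ifP. Qed.

Lemma mseq_cat As Bs : mseq As -> mseq Bs -> mseq (As ++ Bs).
Proof.
move=> mAs mBs i; rewrite size_cat nth_cat.
case: (ltnP i (size As)) => [iA _|Ai iAB]; first exact: mAs.
by apply: mBs; rewrite ltn_subLR.
Qed.

Lemma mseq_in As : mseq As -> {in As, forall A, measurable A}.
Proof. by move=> mAs A /(nthP setT)[i iA <-]; exact: mAs. Qed.

(** Both sides integrate [phi] against a measure: that of [path_int_measure], and the law of
    [Z (size As)] restricted to [cyl As]. On the indicator of [D] they agree by [law] for the list
    [rcons As D]. *)
Lemma path_int_cyl As phi : mseq As -> (forall z, 0 <= phi z) ->
  measurable_fun setT phi ->
  \int[pi]_z path_int Q As phi z = \int[P]_(w in cyl As) phi (Z (size As) w).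
Proof.
move=> mAs phi0 mphi.
have [nu nuE] := path_int_measure Q pi (mseq_in mAs).
have mAcyl := measurable_cyl mAs.
have mphiZ : measurable_fun setT (fun w => phi (Z (size As) w)).
  exact: measurableT_comp mphi (mZ _).
rewrite nuE// -(integral_mrestr P mAcyl)// -(integral_pushmeas _ (mZ (size As)) mphi)//.
apply: eq_measure_integral => D mD _.
transitivity (\int[nu]_z (\1_D z)%:E); first by rewrite integral_indic// setIT.
rewrite -nuE//; last by apply/measurable_EFinP; exact: measurable_indic.
transitivity (\int[pi]_z path_prob Q (rcons As D) z).
  apply: eq_integral => z _; rewrite -cats1 path_prob_cat.
  by congr (path_int _ _ _ _); apply/funext => y; rewrite path_prob1.
rewrite -lawZ; last exact: mseq_rcons.
by rewrite cyl_rcons setIC.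
Qed.

(** The Markov property on a cylinder whose last constrained time is [(size As).-1]: the times
    before [C] are filled with [setT], and [path_prob] of such padding is a power of [Q]. *)
Lemma markov_cyl As k C : mseq As -> As != [::] -> measurable C ->
  P (cyl As `&` Z ((size As).-1 + k.+1)%N @^-1` C) =
  \int[P]_(w in cyl As) Qpow Q k.+1 (Z (size As).-1 w) C.
Proof.
elim/last_ind: As => // As A _ mAsA _ mC.
have mAs : mseq As.
  move=> i iA; have := mAsA i; rewrite size_rcons ltnS => /(_ (ltnW iA)).
  by rewrite nth_rcons iA.
have mA : measurable A.
  by have := mAsA (size As); rewrite size_rcons ltnS leqnn nth_rcons ltnn eqxx => /(_ isT).
rewrite size_rcons /=.
have -> : cyl (rcons As A) `&` Z (size As + k.+1)%N @^-1` C =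
    cyl (rcons As A ++ nseq k setT ++ [:: C]).
  rewrite catA cats1 [RHS]cyl_rcons cyl_cat_setT; by rewrite size_cat size_rcons size_nseq addSnnS.
rewrite lawZ; last first.
  apply: mseq_cat => //; apply: mseq_cat; first exact: mseq_nseq.
  by case.
rewrite cat_rcons.
under eq_integral do rewrite path_prob_cat.
rewrite path_int_cyl//; last 2 first.
- by move=> z; rewrite path_prob_nseq mule_ge0// ?lee_fin// -QiterE.
- apply: (eq_measurable_fun (fun z => (\1_A z)%:E * Qpow Q k.+1 z C)).
    by move=> z _; rewrite path_prob_nseq.
  apply: emeasurable_funM; last exact: measurable_Qpow.
  by apply/measurable_EFinP; exact: measurable_indic.
rewrite cyl_rcons integral_mkcondr; apply: eq_integral => w _.
by rewrite path_prob_nseq epatch_indic muleC.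
Qed.

(** All generating cylinders have the same length, so they intersect set by set. *)
Lemma past_gen_setI m : setI_closed (past_gen m).
Proof.
move=> _ _ [As [sA mA] <-] [Bs [sB mB] <-].
pose Cs := mkseq (fun i => nth setT As i `&` nth setT Bs i) m.+1.
exists Cs.
  split; first by rewrite size_mkseq.
  move=> i; rewrite size_mkseq => im; rewrite nth_mkseq//.
  by apply: measurableI; [apply: mA; rewrite sA|apply: mB; rewrite sB].
apply/seteqP; split=> [w h|w [hA hB] i].
  by split=> i; rewrite ?sA ?sB => im; have := h i; rewrite size_mkseq nth_mkseq// => /(_ im)[].
by rewrite size_mkseq => im; rewrite nth_mkseq//; split; [apply: hA; rewrite sA|apply: hB; rewrite sB].
Qed.

Lemma past_gen_setT m : past_gen m setT.
Proof.
exists (nseq m.+1 setT); first by split; [rewrite size_nseq|exact: mseq_nseq].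
by apply/seteqP; split=> // w _ i _; rewrite nth_nseq; case: ifP.
Qed.

Lemma measurable_to_past m : measurable_fun setT (@to_past m).
Proof.
apply: (measurability (past_gen m : set (set (past m)))) => //.
by move=> _ [_ [As [_ mAs] <-] <-]; rewrite setTI; exact: measurable_cyl.
Qed.

Lemma measurable_past m d' (T' : measurableType d') (f : past m -> T') :
  measurable_fun setT f -> measurable_fun setT (fun w : Omega => f w).
Proof. by move=> mf; exact: (measurableT_comp mf (@measurable_to_past m)). Qed.

Lemma measurable_past_Z m i : (i <= m)%N -> measurable_fun setT (fun w : past m => Z i w).
Proof.
move=> im _ C mC; rewrite setTI; apply: sub_sigma_algebra.
have nthE k : nth setT (set_nth setT (nseq m.+1 setT) i C) k = if k == i then C else setT.
  rewrite nth_set_nth /=; case: eqP => // _.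
  by transitivity (nth setT (nseq m.+1 [set: Zsp]) k) => //; rewrite nth_nseq if_same.
exists (set_nth setT (nseq m.+1 setT) i C).
  split=> [|k _]; first by rewrite size_set_nth size_nseq (maxn_idPr _).
  by rewrite nthE; case: ifP.
apply/seteqP; split=> [w /(_ i)|w Cw k _].
  by rewrite size_set_nth size_nseq (maxn_idPr _)// nthE eqxx ltnS => /(_ im).
by rewrite nthE; case: eqP => [->|].
Qed.

(** The law of the past restricted to [cylJ J js] and the scaled law of the past agree on the
    pi-system of cylinders by [lawJ], hence everywhere. *)
Lemma independence_past m js (f : past m -> \bar R) :
  measurable_fun setT f -> (forall w, 0 <= f w) ->
  \int[P]_(w in cylJ js) f w = (\prod_(j <- js) geom_half j)%:E * \int[P]_w f w.
Proof.
move=> mf f0.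
have g0 : (0 <= \prod_(j <- js) geom_half j :> R)%R.
  by apply: prodr_ge0 => j _; rewrite /geom_half; case: ifP => // _; rewrite invr_ge0 exprn_ge0.
have mf' := measurable_past mf; have mjs := measurable_cylJ js.
rewrite -(integral_mrestr P mjs mf')//.
rewrite -(@integral_pushmeas _ _ _ _ _ (mrestr P mjs) _ (@measurable_to_past m) _ mf)//.
rewrite -(@integral_pushmeas _ _ _ _ _ P _ (@measurable_to_past m) _ mf)//.
rewrite -(ge0_integral_mscale (pushmeas P (@measurable_to_past m)) measurableT (NngNum g0) mf)//.
apply: eq_measure_integral => A mA _.
apply: (measure_unique (past_gen m : set (set (past m))) (fun=> setT)) => //.
- exact: past_gen_setI.
- by move=> _; exact: past_gen_setT.
- by apply/seteqP; split => // w _; exists 0%N.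
- move=> _ [As [_ mAs] <-].
  exact: (etrans (lawJ js mAs) (muleC _ _)).
- move=> _; apply: (@le_lt_trans _ _ 1); last by rewrite ltry.
  by apply: (@probability_le1 _ _ _ P (setT `&` cylJ js)); exact: measurableI.
Qed.

(** The first sides are cylinders only, because these are the events of the past whose probability
    [law] gives directly. *)
Definition rect_gen m : set (set (past m * Zsp)) :=
  [set X | exists A C, [/\ past_gen m A, measurable C & X = A `*` C]].

Arguments rect_gen : clear implicits.

(** Both projections are already measurable for the sigma-algebra generated by these rectangles,
    hence so is the identity map into the product. *)
Lemma rect_genE m : (measurable : set (set (past m * Zsp))) = <<s rect_gen m>>.
Proof.
apply/seteqP; split; last first.
  apply: smallest_sub; first exact: sigma_algebra_measurable.
  move=> _ [A [C [mA mC ->]]]; apply: measurableX => //; exact: sub_sigma_algebra.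
pose W : measurableType _ := g_sigma_algebraType (rect_gen m).
have m1 : measurable_fun setT (fun w : W => (w : past m * Zsp).1).
  apply: (measurability (past_gen m : set (set (past m)))) => //.
  move=> _ [A mA <-]; apply: sub_sigma_algebra; exists A, setT; split => //.
  by rewrite setTI; apply/seteqP; split=> [w|w []].
have m2 : measurable_fun setT (fun w : W => (w : past m * Zsp).2).
  move=> _ C mC; apply: sub_sigma_algebra; exists setT, C; split => //.
  exact: past_gen_setT.
have m12 := measurable_fun_pair m1 m2.
move=> U mU.
suff -> : U = setT `&` (fun w : W => ((w : past m * Zsp).1, (w : past m * Zsp).2)) @^-1` U.
  exact: m12.
by rewrite setTI; apply/seteqP; split=> -[].
Qed.

(** Substitute for conditioning on the past: the joint law of the past and the later state is the
    mixture of [graph_kernel] over the law of the past, since [markov_cyl] identifies the two on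
    rectangles. *)
Lemma markov_integral m k (f : past m * Zsp -> \bar R) :
  measurable_fun setT f -> (forall x, 0 <= f x) ->
  \int[P]_w f (to_past m w, Z (m + k.+1)%N w) =
  \int[P]_w \int[Qiter Q k.+1 (Z m w)]_y f (to_past m w, y).
Proof.
move=> mf f0.
have mg : measurable_fun setT (fun w => (to_past m w, Z (m + k.+1)%N w)).
  by apply: measurable_fun_pair; [exact: measurable_to_past|exact: mZ].
pose K := kernel_precomp (Qiter Q k.+1) (@measurable_past_Z m m (leqnn m)).
pose Pm := fpush P (@measurable_to_past m).
rewrite -(@integral_pushmeas _ _ _ _ _ P _ mg _ mf)//.
have mGf : measurable_fun setT (fun w => \int[graph_kernel K w]_x f x).
  apply: measurable_fun_integral_kernel => // U mU; exact: measurable_kernel.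
transitivity (\int[P]_w \int[graph_kernel K (to_past m w)]_x f x); last first.
  apply: eq_integral => w _.
  by rewrite (@integral_pushmeas _ _ _ _ _ (K w) _ (pair1_measurable (to_past m w)) _ mf).
rewrite -(@integral_pushmeas _ _ _ _ _ P _ (@measurable_to_past m) _ mGf)//; last first.
  by move=> w; exact: integral_ge0.
transitivity (\int[mixture Pm (graph_kernel K)]_x f x); last exact: integral_mixture.
apply: eq_measure_integral => U mU _.
apply: (measure_unique (rect_gen m) (fun=> setT)) => //.
- exact: rect_genE.
- move=> _ _ [A [C [mA mC ->]]] [A' [C' [mA' mC' ->]]].
  exists (A `&` A'), (C `&` C'); split; [exact: past_gen_setI|exact: measurableI|].
  by rewrite setXI.
- by move=> _; exists setT, setT; split=> //; [exact: past_gen_setT|rewrite setXTT].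
- by apply/seteqP; split => // w _; exists 0%N.
- move=> _ [_ [C [[As [sA mAs] <-] mC ->]]].
  have mcyl : measurable (cyl As) by exact: measurable_cyl.
  transitivity (P (cyl As `&` Z ((size As).-1 + k.+1)%N @^-1` C)).
    by rewrite sA.
  rewrite markov_cyl//; last by rewrite -size_eq0 sA.
  transitivity (\int[Pm]_w graph_kernel K w (cyl As `*` C)); last by [].
  have mcyl' : measurable (cyl As : set (past m)).
    by apply: sub_sigma_algebra; exists As.
  have mGU : measurable_fun setT (fun w => graph_kernel K w (cyl As `*` C)).
    by apply: measurable_kernel; exact: measurableX.
  rewrite (@integral_pushmeas _ _ _ _ _ P _ (@measurable_to_past m) _ mGU)//.
  transitivity (\int[P]_w ((\1_(cyl As) w)%:E * Qpow Q k.+1 (Z m w) C)).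
    rewrite integral_mkcond; apply: eq_integral => w _.
    by rewrite epatch_indic muleC sA.
  apply: eq_integral => w _.
  transitivity (Qiter Q k.+1 (Z m w) (xsection (cyl As `*` C) w)); last first.
    by rewrite xsectionE.
  rewrite -QiterE indicE; have [wA|wA] := boolP (w \in cyl As).
    by rewrite in_xsectionX// mul1e.
  by rewrite notin_xsectionX// mul0e measure0.
- move=> _ ; apply: (@le_lt_trans _ _ 1); last by rewrite ltry.
  exact: (@probability_le1 _ _ _ P setT measurableT).
Qed.

End past.

(** * Bounded random variables and their expectations *)

Section bounded_measurable.
Context d (T : measurableType d) (R : realType).
Implicit Types f g : T -> R.

(** The bound holds everywhere, not almost everywhere, so it survives composition with measurable
    maps and freezing of one argument. *)
Definition bmeas f := measurable_fun setT f /\ exists K, forall w, `|f w| <= K.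

Lemma bmeas_cst (c : R) : bmeas (fun=> c).
Proof. by split; [exact: measurable_cst|exists `|c|]. Qed.

Lemma bmeasD f g : bmeas f -> bmeas g -> bmeas (fun w => f w + g w).
Proof.
move=> [mf [K fK]] [mg [L gL]]; split; first exact: measurable_funD.
by exists (K + L) => w; rewrite (le_trans (ler_normD _ _))// lerD.
Qed.

Lemma bmeasM f g : bmeas f -> bmeas g -> bmeas (fun w => f w * g w).
Proof.
move=> [mf [K fK]] [mg [L gL]]; split; first exact: measurable_funM.
by exists (K * L) => w; rewrite normrM ler_pM.
Qed.

Lemma bmeasZ (c : R) f : bmeas f -> bmeas (fun w => c * f w).
Proof. by move=> mf; apply: bmeasM => //; exact: bmeas_cst. Qed.

Lemma bmeasN f : bmeas f -> bmeas (fun w => - f w).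
Proof.
move=> [mf [K fK]]; split; first exact: measurableT_comp.
by exists K => w; rewrite normrN.
Qed.

Lemma bmeasB f g : bmeas f -> bmeas g -> bmeas (fun w => f w - g w).
Proof. by move=> mf mg; apply: bmeasD => //; exact: bmeasN. Qed.

Lemma bmeas_sum (I : Type) (s : seq I) (F : I -> T -> R) :
  (forall i, bmeas (F i)) -> bmeas (fun w => \sum_(i <- s) F i w).
Proof.
move=> mF; elim: s => [|i s IH].
  under eq_fun do rewrite big_nil; exact: bmeas_cst.
by under eq_fun do rewrite big_cons; exact: bmeasD.
Qed.

Lemma bmeas_sqrt f : bmeas f -> bmeas (fun w => Num.sqrt (f w)).
Proof.
move=> [mf [K fK]]; split.
  by apply: measurableT_comp => //; apply: continuous_measurable_fun; exact: sqrt_continuous.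
exists (Num.sqrt K) => w; rewrite ger0_norm ?sqrtr_ge0//.
by rewrite ler_sqrt ?(le_trans _ (fK w))// ler_norm.
Qed.

End bounded_measurable.

Lemma bmeas_comp d d' (T : measurableType d) (T' : measurableType d') (R : realType)
    (g : T -> T') (f : T' -> R) : measurable_fun setT g -> bmeas f ->
  bmeas (fun w => f (g w)).
Proof.
move=> mg [mf [K fK]]; split; first exact: measurableT_comp mf mg.
by exists K => w; exact: fK.
Qed.

Section expectation.
Context d (T : measurableType d) (R : realType) (P : probability T R).
Implicit Types f g : T -> R.

Lemma bmeas_integrable f : bmeas f -> P.-integrable setT (EFin \o f).
Proof.
move=> [mf [K fK]].
apply: measurable_bounded_integrable => //.
  by have := probability_le1 P (@measurableT _ T) => /le_lt_trans; apply; rewrite ltry.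
exists K; split; first exact: num_real.
by move=> x Kx w _; exact: (le_trans (fK w) (ltW Kx)).
Qed.

Lemma EFin_Rintegral f : bmeas f -> (\int[P]_w (f w)%:E)%E = (\int[P]_w f w)%:E.
Proof. by move=> mf; rewrite fineK//; exact: integrable_fin_num (bmeas_integrable mf). Qed.

Lemma expD f g : bmeas f -> bmeas g ->
  \int[P]_w (f w + g w) = \int[P]_w f w + \int[P]_w g w.
Proof. by move=> mf mg; rewrite RintegralD//; exact: bmeas_integrable. Qed.

Lemma expB f g : bmeas f -> bmeas g ->
  \int[P]_w (f w - g w) = \int[P]_w f w - \int[P]_w g w.
Proof. by move=> mf mg; rewrite RintegralB//; exact: bmeas_integrable. Qed.

Lemma expZ (c : R) f : bmeas f -> \int[P]_w (c * f w) = c * \int[P]_w f w.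
Proof. by move=> mf; rewrite RintegralZl//; exact: bmeas_integrable. Qed.

Lemma exp_cst (c : R) : \int[P]_w c = c.
Proof. by rewrite /Rintegral integral_cst_prob. Qed.

Lemma exp_le f g : bmeas f -> bmeas g -> (forall w, f w <= g w) ->
  \int[P]_w f w <= \int[P]_w g w.
Proof. by move=> mf mg fg; apply: le_Rintegral => //; exact: bmeas_integrable. Qed.

Lemma exp_ge0 f : (forall w, 0 <= f w) -> 0 <= \int[P]_w f w.
Proof. by move=> f0; exact: Rintegral_ge0. Qed.

Lemma exp_sum (I : Type) (s : seq I) (F : I -> T -> R) :
  (forall i, bmeas (F i)) ->
  \int[P]_w (\sum_(i <- s) F i w) = \sum_(i <- s) \int[P]_w F i w.
Proof.
move=> mF; elim: s => [|i s IH].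
  by under eq_Rintegral do rewrite big_nil; rewrite big_nil exp_cst.
under eq_Rintegral do rewrite big_cons.
by rewrite expD// ?IH ?big_cons//; exact: bmeas_sum.
Qed.

End expectation.

Section mixing_le.
Context (R : realType) dz (Zsp : measurableType dz) dO (Omega : measurableType dO)
  (P : probability Omega R) (Q : R.-pker Zsp ~> Zsp) (pi : probability Zsp R)
  (Z : nat -> Omega -> Zsp) (J : nat -> Omega -> nat) (tau : nat).
Hypothesis mZ : forall i, measurable_fun setT (Z i).
Hypothesis law : forall (As : seq (set Zsp)) (js : seq nat), mseq As ->
  P [set w | cyl Z As w /\ cylJ J js w]
  = ((\int[pi]_z path_prob Q As z) * (\prod_(j <- js) geom_half j)%:E)%E.
Hypothesis piQ : kernel_invariant Q pi.
Hypothesis mix : forall (k : nat) (z z' : Zsp),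
  half_tv_le (Qpow Q k z) (Qpow Q k z') ((4^-1) ^+ (k %/ tau)).

(** For a frozen past, [h + H] takes values in [[0, 2 * H]] and has [pi]-mean [H], so
    [tv_integral_le] costs [2 * H] times the mixing rate. The shift by [H] also provides the
    nonnegativity that [markov_integral] asks for. *)
Lemma mixing_le m k (h : past Z m * Zsp -> R) (H : past Z m -> R) :
  bmeas h -> bmeas H -> (forall w y, `|h (w, y)| <= H w) ->
  (forall w, \int[pi]_y h (w, y) = 0) ->
  \int[P]_w h (to_past Z m w, Z (m + k.+1)%N w) <=
  2 * (4^-1) ^+ (k.+1 %/ tau) * \int[P]_w H (to_past Z m w).
Proof.
move=> bh bH hH pih; set rho : R := _ ^+ _.
have rho0 : 0 <= rho by rewrite exprn_ge0.
have mto := measurable_to_past mZ (m := m).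
have bH' : bmeas (fun w => H (to_past Z m w)) by exact: bmeas_comp bH.
have mg : measurable_fun setT (fun w => (to_past Z m w, Z (m + k.+1)%N w)).
  exact: measurable_fun_pair.
have bh' : bmeas (fun w => h (to_past Z m w, Z (m + k.+1)%N w)) by exact: (bmeas_comp mg bh).
have H0 w : 0 <= H w by exact: le_trans (hH w point).
have bH1 : bmeas (fun x : past Z m * Zsp => H x.1) by exact: (bmeas_comp measurable_fst bH).
have bhH := bmeasD bh bH1.
have hH0 x : 0 <= h x + H x.1.
  by have := hH x.1 x.2; rewrite -surjective_pairing ler_norml => /andP[+ _]; rewrite -subr_ge0 opprK addrC.
have := markov_integral mZ law k (proj2 (measurable_EFinP _ _) bhH.1) (fun x => hH0 x).
rewrite /= (_ : (\int[P]_w _)%E =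
  (\int[P]_w h (to_past Z m w, Z (m + k.+1)%N w) + \int[P]_w H (to_past Z m w))%:E); last first.
  by rewrite -expD// EFin_Rintegral//; exact: bmeasD.
move=> E1.
rewrite -(lerD2r (\int[P]_w H (to_past Z m w))) -lee_fin E1.
have bh_w w : bmeas (fun y => h (w, y)).
  by exact: (bmeas_comp (pair1_measurable w) bh).
apply: (@le_trans _ _ (\int[P]_w (2 * rho * H (to_past Z m w) + H (to_past Z m w))%:E)%E).
  apply: ge0_le_integral => //.
  - by move=> w _; apply: integral_ge0 => y _; rewrite lee_fin; exact: (hH0 (w, y)).
  - apply: (@measurable_past _ _ _ _ Z mZ m _ _ (fun w : past Z m =>
      \int[Qiter Q k.+1 (Z m w)]_y (h (w, y) + H w)%:E)%E).
    apply: (@measurable_fun_integral_finite_kernel _ _ _ _ _ (fun x : past Z m * Zsp => (h x + H x.1)%:E)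
      (kernel_precomp (Qiter Q k.+1) (@measurable_past_Z _ _ _ _ Z m m (leqnn m)))) => //.
    by apply/measurable_EFinP; case: bhH.
  - by apply/measurable_EFinP; apply: measurable_funD; [apply: measurable_funM => //; case: bH'|case: bH'].
  move=> w _.
  apply: (le_trans (@tv_integral_le _ _ _ _ pi rho (2 * H (to_past Z m w)) (fun y => h (w, y) + H w) _ _ _ _ _ _)) => //.
  - exact: (etrans (QiterE Q k.+1 (Z m w) setT) (Qpow_setT Q k.+1 (Z m w))).
  - exact: probability_setT.
  - exact: (Qiter_tv_pi piQ mix k.+1 (Z m w)).
  - by apply: measurable_funD => //; case: (bh_w w).
  - move=> y; rewrite (hH0 (w, y))/= mulr2n mulrDl mul1r lerD2r.
    by rewrite (le_trans (ler_norm _))// hH.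
  have -> : (\int[pi]_y (h (w, y) + H w)%:E)%E = (H w)%:E.
    rewrite EFin_Rintegral; last by apply: bmeasD => //; exact: bmeas_cst.
    by rewrite expD// ?pih ?add0r ?exp_cst//; exact: bmeas_cst.
  by rewrite -EFinD lee_fin addrC mulrAC.
rewrite EFin_Rintegral; last by apply: bmeasD => //; exact: bmeasZ.
by rewrite lee_fin expD// ?expZ//; exact: bmeasZ.
Qed.

End mixing_le.

(** * Joint measurability of functions and their gradients *)

Section caratheodory.
Context (R : realType) (d : nat) dT (T : measurableType dT)
  dz (Zsp : measurableType dz).

Definition vmeas dT (T : measurableType dT) (X : T -> 'rV[R]_d) :=
  forall i, measurable_fun setT (fun w => X w ord0 i).

(* Round the state to a grid: only countably many values of the first argument
   of [F] then occur, and continuity removes the rounding in the limit. *)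
Lemma measurable_caratheodory (X : T -> 'rV[R]_d) (Y : T -> Zsp)
    (F : 'rV[R]_d -> Zsp -> R) : vmeas X -> measurable_fun setT Y ->
  (forall x, measurable_fun setT (F x)) ->
  (forall z, continuous (fun x => F x z)) ->
  measurable_fun setT (fun w => F (X w) (Y w)).
Proof.
move=> mX mY mF cF.
pose q n (c : 'rV[int]_d) : 'rV[R]_d := \row_i ((c ord0 i)%:~R / n.+1%:R).
pose c n w : 'rV[int]_d := \row_i Num.floor (n.+1%:R * X w ord0 i).
apply: (@measurable_fun_cvg _ _ _ _ (fun n w => F (q n (c n w)) (Y w))).
- move=> n _ B mB; rewrite setTI.
  have -> : (fun w => F (q n (c n w)) (Y w)) @^-1` B =
      \bigcup_(a : 'rV[int]_d) ([set w | c n w = a] `&` (Y @^-1` (F (q n a) @^-1` B))).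
    apply/seteqP; split=> [w Bw|w [a _ [<-]]//].
    by exists (c n w).
  apply: countable_bigcupT_measurable; first exact: countableP.
  move=> a; apply: measurableI; last first.
    by rewrite -[X in measurable X]setTI; apply: mY => //; rewrite -[X in measurable X]setTI; exact: mF.
  have -> : [set w | c n w = a] =
      \big[setI/setT]_(i < d) [set w | (a ord0 i)%:~R <= n.+1%:R * X w ord0 i < (a ord0 i + 1)%:~R].
    apply/seteqP; split=> [w <-|w h].
      by elim/big_ind : _ => //= i _; rewrite mxE; exact: floor_itv.
    apply/rowP => i; rewrite mxE; apply: floor_def.
    by move: h; rewrite (bigD1 i)//= => -[].
  apply: bigsetI_measurable => i _.
  have mXi : measurable_fun setT (fun w => n.+1%:R * X w ord0 i).
    by apply: measurable_funM => //; exact: mX.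
  have := mXi measurableT _ (measurable_itv `[(a ord0 i)%:~R, (a ord0 i + 1)%:~R[).
  rewrite setTI; congr (measurable _).
- move=> w _.
  have qX : q n (c n w) @[n --> \oo] --> X w.
    apply/cvgrPdist_lt => e e0.
    near=> n.
    have ne : (n.+1%:R^-1 : R) < e.
      by near: n; exact: near_infty_natSinv_lt (PosNum e0).
    rewrite (_ : `|_| = mx_norm (X w - q n (c n w)))//.
    have [->//|/mx_norm_neq0[[i j] ->]/=] := eqVneq (mx_norm (X w - q n (c n w))) 0.
    rewrite ord1 !mxE.
    have /andP[fl1 fl2] := floor_itv (n.+1%:R * X w ord0 j).
    apply: le_lt_trans ne.
    have E1 : (Num.floor (n.+1%:R * X w ord0 j))%:~R / n.+1%:R <= X w ord0 j.
      by rewrite ler_pdivrMr ?ltr0Sn// [leRHS]mulrC.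
    have E2 : X w ord0 j <= (Num.floor (n.+1%:R * X w ord0 j))%:~R / n.+1%:R + n.+1%:R^-1.
      rewrite -[X in _ + X]mul1r -mulrDl ler_pdivlMr ?ltr0Sn// [leLHS]mulrC.
      by rewrite ltW// (lt_le_trans fl2)// intrD.
    by rewrite ger0_norm ?subr_ge0// lerBlDl.
  by move=> A nA; exact: (qX _ (cF (Y w) (X w) A nA)).
Unshelve. all: by end_near. Qed.

(** Difference quotients along the fixed sequence of steps [n.+1%:R^-1] exhibit each gradient
    coordinate as a sequential limit, through which measurability passes. *)
Lemma gradient_cvg (f : 'rV[R]_d -> R) (g x : 'rV[R]_d) (i : 'I_d) :
  is_gradient f g x ->
  n.+1%:R * (f (x + n.+1%:R^-1 *: delta_mx ord0 i) - f x) @[n --> \oo] --> g ord0 i.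
Proof.
move=> [df dfE].
have dd := @diff_derivable _ _ _ f x (delta_mx ord0 i) df.
have : 'D_(delta_mx ord0 i) f x = g ord0 i.
  rewrite deriveE// dfE /dotv (bigD1 i)//= mxE !eqxx mulr1 big1 ?addr0// => j ji.
  by rewrite mxE (negPf ji) andbF mulr0.
move=> Dg; move: dd; rewrite /derivable -/(derive f x (delta_mx ord0 i)) Dg.
move=> /cvgr_dnbhsP /(_ (fun n => n.+1%:R^-1)).
have h0 n : (n.+1%:R^-1 : R) != 0 by rewrite invr_eq0.
move=> /(_ (conj h0 cvg_harmonic)).
apply: cvg_trans; apply: near_eq_cvg; near=> n.
by rewrite /= invrK [n.+1%:R^-1 *: _ + _]addrC.
Unshelve. all: by end_near. Qed.

Lemma measurable_gradient (X : T -> 'rV[R]_d) (Y : T -> Zsp)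
    (F : 'rV[R]_d -> Zsp -> R) (G : 'rV[R]_d -> Zsp -> 'rV[R]_d) :
  vmeas X -> measurable_fun setT Y ->
  (forall x, measurable_fun setT (F x)) ->
  (forall x z, is_gradient (fun y => F y z) (G x z) x) ->
  vmeas (fun w => G (X w) (Y w)).
Proof.
move=> mX mY mF gF i.
have cF z : continuous (fun x => F x z).
  by move=> x; apply: differentiable_continuous; case: (gF x z).
apply: (@measurable_fun_cvg _ _ _ _ (fun n w =>
   n.+1%:R * (F (X w + n.+1%:R^-1 *: delta_mx ord0 i) (Y w) - F (X w) (Y w)))).
  move=> n; apply: measurable_funM => //; apply: measurable_funB.
    apply: (measurable_caratheodory (X := fun w => X w + _)) => // j.
    under eq_fun do rewrite mxE.
    by apply: measurable_funD => //; exact: mX.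
  exact: measurable_caratheodory.
move=> w _; exact: (gradient_cvg (gF (X w) (Y w))).
Qed.

End caratheodory.

(** * The deterministic step *)

Section euclidean.
Context (R : realType) (d : nat).
Implicit Types u v w : 'rV[R]_d.

Lemma dotvC u v : dotv u v = dotv v u.
Proof. by apply: eq_bigr => i _; rewrite mulrC. Qed.

Lemma dotvDl u v w : dotv (u + v) w = dotv u w + dotv v w.
Proof. by rewrite -big_split; apply: eq_bigr => i _; rewrite mxE mulrDl. Qed.

Lemma dotvZl (a : R) u v : dotv (a *: u) v = a * dotv u v.
Proof. by rewrite /dotv mulr_sumr; apply: eq_bigr => i _; rewrite mxE mulrA. Qed.

Lemma dotvDr u v w : dotv u (v + w) = dotv u v + dotv u w.
Proof. by rewrite dotvC dotvDl !(dotvC u). Qed.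

Lemma dotvZr (a : R) u v : dotv u (a *: v) = a * dotv u v.
Proof. by rewrite dotvC dotvZl dotvC. Qed.

Lemma dotvNl u v : dotv (- u) v = - dotv u v.
Proof. by rewrite -scaleN1r dotvZl mulN1r. Qed.

Lemma dotvNr u v : dotv u (- v) = - dotv u v.
Proof. by rewrite dotvC dotvNl dotvC. Qed.

Lemma dotvBl u v w : dotv (u - v) w = dotv u w - dotv v w.
Proof. by rewrite dotvDl dotvNl. Qed.

Lemma dotvBr u v w : dotv u (v - w) = dotv u v - dotv u w.
Proof. by rewrite dotvDr dotvNr. Qed.

Lemma dotv_suml (I : Type) (r : seq I) (F : I -> 'rV[R]_d) v :
  dotv (\sum_(i <- r) F i) v = \sum_(i <- r) dotv (F i) v.
Proof.
elim/big_rec2 : _ => [|i y z _ <-]; last by rewrite dotvDl.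
by rewrite -(scale0r (0 : 'rV_d)) dotvZl mul0r.
Qed.

Lemma dotv_sumr (I : Type) (r : seq I) (F : I -> 'rV[R]_d) v :
  dotv v (\sum_(i <- r) F i) = \sum_(i <- r) dotv v (F i).
Proof. by rewrite dotvC dotv_suml; apply: eq_bigr => i _; rewrite dotvC. Qed.

Definition dotvE := (dotvDl, dotvDr, dotvNl, dotvNr, dotvZl, dotvZr).

Lemma dotvv_ge0 u : 0 <= dotv u u.
Proof. by apply: sumr_ge0 => i _; rewrite -expr2 sqr_ge0. Qed.

Lemma enorm_ge0 u : 0 <= enorm u.
Proof. exact: sqrtr_ge0. Qed.

Lemma enorm_sqr u : enorm u ^+ 2 = dotv u u.
Proof. by rewrite sqr_sqrtr// dotvv_ge0. Qed.

Lemma enormZ (a : R) u : enorm (a *: u) = `|a| * enorm u.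
Proof. by rewrite /enorm dotvZl dotvZr mulrA -expr2 sqrtrM ?sqr_ge0// sqrtr_sqr. Qed.

Lemma enormN u : enorm (- u) = enorm u.
Proof. by rewrite -scaleN1r enormZ normrN1 mul1r. Qed.

Lemma dotvv_eq0 u : dotv u u = 0 -> u = 0.
Proof.
move=> /eqP; rewrite psumr_eq0 => [/allP h|i _]; last by rewrite -expr2 sqr_ge0.
apply/rowP => i; rewrite mxE; have := h i (mem_index_enum _).
by rewrite /= -expr2 sqrf_eq0 => /eqP.
Qed.

(** Cauchy-Schwarz, read off from the squared norm of [enorm v *: u - enorm u *: v]. A factor
    [enorm u * enorm v] is cancelled at the end, hence the two degenerate cases. *)
Lemma dotv_le u v : dotv u v <= enorm u * enorm v.
Proof.
have [u0|u0] := eqVneq (enorm u) 0.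
  have -> : u = 0 by apply: dotvv_eq0; rewrite -enorm_sqr u0 expr0n.
  by rewrite -(scale0r (0 : 'rV_d)) dotvZl mul0r mulr_ge0 ?enorm_ge0.
have [v0|v0] := eqVneq (enorm v) 0.
  have -> : v = 0 by apply: dotvv_eq0; rewrite -enorm_sqr v0 expr0n.
  by rewrite -(scale0r (0 : 'rV_d)) dotvZr mul0r mulr_ge0 ?enorm_ge0.
have uv0 : 0 < enorm u * enorm v by rewrite mulr_gt0// lt_neqAle eq_sym enorm_ge0 ?u0 ?v0.
have := dotvv_ge0 (enorm v *: u - enorm u *: v).
rewrite !dotvE (dotvC v u) -!enorm_sqr.
rewrite [leRHS](_ : _ = 2 * (enorm u * enorm v) * (enorm u * enorm v - dotv u v)); last by ring.
by rewrite pmulr_rge0 ?subr_ge0// mulr_gt0.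
Qed.

Lemma normr_dotv_le u v : `|dotv u v| <= enorm u * enorm v.
Proof.
by rewrite ler_norml dotv_le andbT lerNl -dotvNl (le_trans (dotv_le _ _))// enormN.
Qed.

Lemma normr_coord_le u i : `|u ord0 i| <= enorm u.
Proof.
rewrite -[leLHS]sqrtr_sqr ler_sqrt ?dotvv_ge0//.
by rewrite /dotv (bigD1 i)//= -expr2 lerDl; apply: sumr_ge0 => j _; rewrite -expr2 sqr_ge0.
Qed.

Lemma enorm_sqrD u v : enorm (u + v) ^+ 2 = enorm u ^+ 2 + 2 * dotv u v + enorm v ^+ 2.
Proof. by rewrite !enorm_sqr !dotvE (dotvC v u); ring. Qed.

Lemma enorm_sqrB u v : enorm (u - v) ^+ 2 = enorm u ^+ 2 - 2 * dotv u v + enorm v ^+ 2.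
Proof. by rewrite enorm_sqrD dotvNr enormN mulrN. Qed.

Lemma enorm_sqrD_le u v : enorm (u + v) ^+ 2 <= 2 * enorm u ^+ 2 + 2 * enorm v ^+ 2.
Proof.
have := sqr_ge0 (enorm (u - v)); rewrite enorm_sqrB enorm_sqrD; lra.
Qed.

End euclidean.

Section one_step.
Context (R : realType) (d : nat).
Implicit Types u v w : 'rV[R]_d.
Variables (f : 'rV[R]_d -> R) (gradf : 'rV[R]_d -> 'rV[R]_d) (xs : 'rV[R]_d).
Variables (L mu gamma p beta eta : R).
Hypothesis Lip : forall x y, enorm (gradf x - gradf y) <= L * enorm (x - y).
Hypothesis scvx : forall x y,
  f x - f y - dotv (gradf y) (x - y) >= mu / 2 * enorm (x - y) ^+ 2.
Hypothesis mu0 : 0 < mu.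
Hypothesis gamma0 : 0 < gamma.
Hypothesis p0 : 0 < p.
Hypothesis eta0 : 0 < eta.
Hypothesis p_eta : p <= eta.
Hypothesis eta2 : eta ^+ 2 * (mu * gamma) = 3.
Hypothesis betaE : beta * 3 = 2 * eta * gamma * p * mu.

(* Convexity bounds [f x - f y] by the gradient at [x], so the Lipschitz bound
   gives the descent inequality with constant [L] rather than [L / 2]. *)
Lemma descent x y : f x <= f y + dotv (gradf y) (x - y) + L * enorm (x - y) ^+ 2.
Proof.
have h1 := scvx y x.
have h2 : 0 <= mu / 2 * enorm (y - x) ^+ 2.
  by rewrite mulr_ge0 ?sqr_ge0// divr_ge0// ltW.
have h3 : dotv (gradf x - gradf y) (x - y) <= L * enorm (x - y) ^+ 2.
  rewrite (le_trans (dotv_le _ _))// expr2 mulrA.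
  by rewrite ler_wpM2r ?enorm_ge0.
have h4 : dotv (gradf x) (y - x) = - dotv (gradf x) (x - y) by rewrite -dotvNr opprB.
move: h3; rewrite dotvBl; lra.
Qed.

(** Since [6 / mu = 2 * eta ^+ 2 * gamma], the values [f xg] coming from the descent inequality and
    from the two convexity bounds cancel. Strong convexity contributes [- 3 / 2 * beta] times
    [enorm (xg - xs) ^+ 2] and the average [y] contributes [beta], which leaves [- beta / 2]. *)
Lemma one_step (x xf xg g : 'rV[R]_d) :
  let xf' := xg - (p * gamma) *: g in
  let x' := eta *: xf' + (p - eta) *: xf + ((1 - p) * (1 - beta)) *: x
            + ((1 - p) * beta) *: xg in
  let y := (1 - beta) *: x + beta *: xg in
  let c := eta ^+ 2 * p ^+ 2 * gamma ^+ 2 * (1 + 2 * L * gamma) in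
  (eta - beta * p) *: xg = (eta - p) *: xf + (p * (1 - beta)) *: x ->
  enorm (x' - xs) ^+ 2 + 6 / mu * (f xf' - f xs) <=
  (1 - beta) * enorm (x - xs) ^+ 2 + (1 - p / eta) * (6 / mu * (f xf - f xs))
  - beta / 2 * enorm (xg - xs) ^+ 2 - beta * (1 - beta) * enorm (x - xg) ^+ 2
  - 2 * eta * p * gamma * dotv (y - xs) (g - gradf xg)
  + c * enorm g ^+ 2 - 2 * eta ^+ 2 * p * gamma ^+ 2 * dotv (gradf xg) g.
Proof.
move=> xf' x' y c xgE.
(* The relation for [xg] turns the four-term update into a gradient step started at [y]. *)
have x'E : x' - xs = (y - xs) - (eta * p * gamma) *: g.
  apply/rowP => i; have := congr1 (fun v : 'rV[R]_d => v ord0 i) xgE.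
  rewrite /x' /xf' /y !mxE => h; lra.
(* The same relation expresses [y - xs] through [xg - xf], where convexity applies, and [xg - xs],
   where strong convexity applies. *)
have yE : p *: (y - xs) = (eta - p) *: (xg - xf) + p *: (xg - xs).
  apply/rowP => i; have := congr1 (fun v : 'rV[R]_d => v ord0 i) xgE.
  rewrite /y !mxE => h; lra.
have ynorm : enorm (y - xs) ^+ 2 = (1 - beta) * enorm (x - xs) ^+ 2 +
   beta * enorm (xg - xs) ^+ 2 - beta * (1 - beta) * enorm (x - xg) ^+ 2.
  have -> : y - xs = (xg - xs) + (1 - beta) *: (x - xg).
    by apply/rowP => i; rewrite /y !mxE; ring.
  have -> : x - xs = (xg - xs) + (x - xg) by apply/rowP => i; rewrite !mxE; ring.
  move: (xg - xs) (x - xg) => a b.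
  by rewrite !enorm_sqr !dotvE (dotvC b a); ring.
have dotE : p * dotv (gradf xg) (y - xs) =
    (eta - p) * dotv (gradf xg) (xg - xf) + p * dotv (gradf xg) (xg - xs).
  by rewrite -!dotvZr yE dotvDr.
have c1 : f xg - f xf <= dotv (gradf xg) (xg - xf).
  have := scvx xf xg; rewrite -[xf - xg]opprB dotvNr enormN.
  have : 0 <= mu / 2 * enorm (xg - xf) ^+ 2.
    by rewrite mulr_ge0 ?sqr_ge0// divr_ge0// ltW.
  lra.
have c2 : f xg - f xs + mu / 2 * enorm (xg - xs) ^+ 2 <= dotv (gradf xg) (xg - xs).
  have := scvx xs xg; rewrite -[xs - xg]opprB dotvNr enormN; lra.
have c3 : f xf' <= f xg - p * gamma * dotv (gradf xg) g + L * (p * gamma) ^+ 2 * enorm g ^+ 2.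
  have := descent xf' xg; rewrite /xf' [_ - xg]addrC addKr dotvNr dotvZr enormN enormZ.
  by rewrite exprMn real_normK ?num_real// mulrA.
have mu6 : 6 / mu = 2 * eta ^+ 2 * gamma.
  have six : 6 = 2 * (eta ^+ 2 * (mu * gamma)) :> R by rewrite eta2; ring.
  by rewrite six; field; rewrite gt_eqF.
rewrite x'E (enorm_sqrB (y - xs) ((eta * p * gamma) *: g)) enormZ exprMn.
rewrite real_normK ?num_real// dotvZr dotvBr ynorm mu6.
have p_etaE : (1 - p / eta) * (2 * eta ^+ 2 * gamma * (f xf - f xs)) =
   2 * eta * gamma * (eta - p) * (f xf - f xs).
  by field; rewrite gt_eqF.
rewrite p_etaE (dotvC (y - xs) (gradf xg)) /c.
have e0 : 0 <= 2 * eta * gamma by rewrite !mulr_ge0 ?ltW.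
have k1 := ler_wpM2l (mulr_ge0 e0 (_ : 0 <= eta - p)) c1.
have {k1} := k1 (etrans (subr_ge0 _ _) p_eta) => k1.
have k2 := ler_wpM2l (mulr_ge0 e0 (ltW p0)) c2.
have k3 := ler_wpM2l (mulr_ge0 e0 (ltW eta0)) c3.
have k4 := congr1 (fun z => 2 * eta * gamma * z) dotE.
have k5 := congr1 (fun z => enorm (xg - xs) ^+ 2 * z) betaE.
move: k1 k2 k3 k4 k5 => /=; clear.
move: (dotv _ (y - xs)) (dotv _ (xg - xf)) (dotv _ (xg - xs)) (dotv _ g) (dotv _ g).
move: (enorm _) (enorm _) (enorm _) (enorm _) => *; lra.
Qed.

End one_step.

(** * Scalar estimates *)

Section scalar.
Variable R : realType.

(** [r] stands for [enorm (y - xs)], [n] for the gradient norm at [xg], [kap] and [kap1] for the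
    variance and bias factors. Young's inequality charges the bias along [y - xs] to
    [beta / 2 * r ^+ 2] and the bias along the gradient to [- 2 * q * n ^+ 2]. The remaining
    multiple of [sigma ^+ 2] is [5 / 2 * (111 / 20) + 10 / 51 <= 15]. *)
Lemma noise_budget (p gamma L eta beta K delta sigma kap kap1 r n S q c : R) :
  0 < gamma -> 0 < L -> gamma * L <= 3 / 4 -> 0 < p -> 0 < eta -> 0 < beta ->
  0 <= K -> 0 <= kap -> kap <= 111 / 20 * K ->
  p * (2 * (1 + gamma * L) * (1 + 4 * K * delta ^+ 2)) <= 1 ->
  kap1 ^+ 2 * (1 + 2 * p / beta) <= p * K / 51 ->
  S = sigma ^+ 2 + delta ^+ 2 * n ^+ 2 ->
  q = eta ^+ 2 * p * gamma ^+ 2 ->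
  c = q * (p * (1 + 2 * L * gamma)) ->
  c * n ^+ 2 - 2 * q * n ^+ 2 + c * (kap * S)
  + 2 * eta * p * gamma * (r * (kap1 * Num.sqrt S))
  + 2 * q * (n * (kap1 * Num.sqrt S))
  <= beta / 2 * r ^+ 2 + 15 * (q * (p * K * sigma ^+ 2)).
Proof.
move=> gamma0 L0 u34 p0 eta0 beta0 K0 kap0 kapK hp hk1 SE qE cE.
have S0 : 0 <= S by rewrite SE; apply: addr_ge0; [exact: sqr_ge0|apply: mulr_ge0; exact: sqr_ge0].
have sS : Num.sqrt S ^+ 2 = S by rewrite sqr_sqrtr.
have q0 : 0 < q by rewrite qE !mulr_gt0 ?exprn_gt0.
set s := Num.sqrt S in sS *.
(* The weights of both AM-GM steps are chosen so that the constants [111 / 20]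
   and [1 / 51] leave less than [2 * n ^+ 2] in [key]. *)
have amgm1 : 2 * eta * p * gamma * (r * (kap1 * s)) <=
    beta / 2 * r ^+ 2 + q * (2 * p / beta * (kap1 ^+ 2 * S)).
  rewrite -subr_ge0.
  rewrite (_ : _ - _ = (beta * r - 2 * eta * p * gamma * (kap1 * s)) ^+ 2 / (2 * beta)).
    by rewrite divr_ge0 ?sqr_ge0// mulr_ge0// ltW.
  by rewrite -sS qE; field; rewrite gt_eqF.
have amgm2 : 2 * (n * (kap1 * s)) <= n ^+ 2 / 10 + 10 * (kap1 ^+ 2 * S).
  rewrite -subr_ge0 (_ : _ - _ = (n - 10 * (kap1 * s)) ^+ 2 / 10).
    by rewrite divr_ge0 ?sqr_ge0.
  by rewrite -sS; field.
pose P := p * (1 + 2 * L * gamma).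
pose a := p * (1 + gamma * L).
have u0 : 0 < gamma * L by rewrite mulr_gt0.
have d0 : 0 <= K * delta ^+ 2 by rewrite mulr_ge0 ?sqr_ge0.
have a0 : 0 < a by rewrite mulr_gt0// ltr_wpDr ?ltW.
have P0 : 0 <= P by rewrite mulr_ge0 ?ltW// ltr_wpDr// !mulr_ge0 ?ltW.
(* [10 / 7] and, below, [5 / 2] are the values of [(1 + 2 * u) / (1 + u)] and [1 + 2 * u] at the
   extreme [u = gamma * L = 3 / 4]. *)
have Pa : P <= 10 / 7 * a.
  rewrite /P /a mulrCA ler_pM2l//; lra.
have P52 : P <= 5 / 2 * p.
  rewrite /P mulrC ler_pM2r//; lra.
(* The condition on [p], halved. It yields both [a <= 1 / 2] and [a * (K * delta ^+ 2) <= 1 / 8]. *)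
have ab : a + 4 * (a * (K * delta ^+ 2)) <= 1 / 2.
  have -> : a + 4 * (a * (K * delta ^+ 2)) =
     p * (2 * (1 + gamma * L) * (1 + 4 * K * delta ^+ 2)) / 2 by rewrite /a; field.
  lra.
have b0 : 0 <= a * (K * delta ^+ 2) by rewrite mulr_ge0// ltW.
have a12 : a <= 1 / 2 by lra.
have b18 : a * (K * delta ^+ 2) <= 1 / 8 by lra.
have pa : p <= a by rewrite /a ler_peMr ?ltW// ltrDl.
have pb18 : p * (K * delta ^+ 2) <= 1 / 8.
  by apply: le_trans b18; rewrite ler_wpM2r.
have PK : P * (K * delta ^+ 2) <= 10 / 7 * (1 / 8).
  by have := ler_wpM2r d0 Pa; move: b18; clear; lra.
have k1S : (10 + 2 * p / beta) * (kap1 ^+ 2 * S) <= 10 * (p * K / 51) * S.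
  rewrite mulrA ler_wpM2r//.
  have pb0 : 0 <= 2 * p / beta by apply: divr_ge0; rewrite ?mulr_ge0 ?ltW.
  have pbk : 0 <= 2 * p / beta * kap1 ^+ 2 by apply: mulr_ge0 => //; exact: sqr_ge0.
  move: hk1 pbk; clear; lra.
have n0 : 0 <= n ^+ 2 by rewrite sqr_ge0.
have s0 : 0 <= sigma ^+ 2 by rewrite sqr_ge0.
have PkS : P * (kap * S) <= 111 / 20 * (P * (K * S)).
  have := ler_wpM2l P0 (ler_wpM2r S0 kapK); clear; lra.
have key : P * n ^+ 2 - 2 * n ^+ 2 + P * (kap * S) + n ^+ 2 / 10
   + (10 + 2 * p / beta) * (kap1 ^+ 2 * S) <= 15 * (p * K * sigma ^+ 2).
  have E1 : P * (K * S) = P * (K * sigma ^+ 2) + P * (K * delta ^+ 2) * n ^+ 2.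
    by rewrite SE; ring.
  have E2 : 10 * (p * K / 51) * S =
     10 / 51 * (p * K * sigma ^+ 2) + 10 / 51 * (p * (K * delta ^+ 2) * n ^+ 2).
    by rewrite SE; field.
  have h1 : P * (K * sigma ^+ 2) <= 5 / 2 * (p * K * sigma ^+ 2).
    have := ler_wpM2r (mulr_ge0 K0 s0) P52; clear; lra.
  have h2 := ler_wpM2r n0 PK.
  have h3 := ler_wpM2r n0 pb18.
  have h4 : P * n ^+ 2 <= 5 / 7 * n ^+ 2 by apply: ler_wpM2r => //; move: Pa a12; clear; lra.
  have h5 : 0 <= p * K * sigma ^+ 2.
    by apply: mulr_ge0 => //; apply: mulr_ge0 => //; exact: ltW.
  move: PkS k1S E1 E2 h1 h2 h3 h4 h5 n0; clear; lra.
have {key} := ler_wpM2l (ltW q0) key.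
have {amgm2} := ler_wpM2l (ltW q0) amgm2.
move: amgm1; rewrite cE -/P; clear; lra.
Qed.

(** The exponent is constant on blocks of length [tau]; padding [n] to [n * tau] leaves [tau] times
    a geometric sum of ratio [1 / 4]. *)
Lemma sum_geom_blocks (tau n : nat) : (0 < tau)%N ->
  \sum_(l < n) (4^-1 : R) ^+ (l %/ tau) <= 4 / 3 * tau%:R.
Proof.
move=> tau0.
have blocks m : \sum_(l < m * tau) (4^-1 : R) ^+ (l %/ tau) =
    4 / 3 * tau%:R * (1 - 4^-1 ^+ m).
  elim: m => [|m IH]; first by rewrite big_ord0 expr0 subrr mulr0.
  rewrite mulSnr big_split_ord/= IH.
  rewrite (eq_bigr (fun=> 4^-1 ^+ m)); last first.
    by move=> i _; rewrite divnMDl// divn_small// addn0.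
  by rewrite sumr_const card_ord -mulr_natr exprS; field.
apply: (@le_trans _ _ (\sum_(l < n * tau) (4^-1 : R) ^+ (l %/ tau))).
  have -> : (n * tau = n + (n * tau - n))%N by rewrite subnKC// leq_pmulr.
  by rewrite big_split_ord/= lerDl sumr_ge0// => i _; rewrite exprn_ge0.
rewrite blocks ler_piMr ?mulr_ge0// lerBlDr lerDl exprn_ge0//.
Qed.

Lemma geom_sum_tail (l k : nat) :
  \sum_(j < l.+1 + k) geom_half j = 1 - (2^-1 : R) ^+ (l + k).
Proof.
elim: k => [|k IH].
  rewrite !addn0; elim: l => [|l IH]; first by rewrite big_ord1 /geom_half/= expr0 subrr.
  by rewrite big_ord_recr IH /geom_half/= -exprVn exprS; field.
by rewrite addnS big_ord_recr IH/= /geom_half/= addSn /= -exprVn addnS exprS; field.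
Qed.

End scalar.

(** * Noise of the multilevel estimator *)

Section bounded_vectors.
Context (R : realType) (d : nat) dT (T : measurableType dT).
Implicit Types X Y : T -> 'rV[R]_d.

Definition bvmeas X := forall i, bmeas (fun w => X w ord0 i).

Lemma bvmeas_vmeas X : bvmeas X -> vmeas X.
Proof. by move=> bX i; case: (bX i). Qed.

Lemma bvmeas_cst (x : 'rV[R]_d) : bvmeas (fun=> x).
Proof. by move=> i; exact: bmeas_cst. Qed.

Lemma bvmeasD X Y : bvmeas X -> bvmeas Y -> bvmeas (fun w => X w + Y w).
Proof. by move=> bX bY i; under eq_fun do rewrite mxE; exact: bmeasD. Qed.

Lemma bvmeasZ (a : R) X : bvmeas X -> bvmeas (fun w => a *: X w).
Proof. by move=> bX i; under eq_fun do rewrite mxE; exact: bmeasZ. Qed.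

Lemma bvmeasN X : bvmeas X -> bvmeas (fun w => - X w).
Proof. by move=> bX i; under eq_fun do rewrite mxE; exact: bmeasN. Qed.

Lemma bvmeasB X Y : bvmeas X -> bvmeas Y -> bvmeas (fun w => X w - Y w).
Proof. by move=> bX bY; apply: bvmeasD => //; exact: bvmeasN. Qed.

Lemma bvmeas_sum (I : Type) (s : seq I) (F : I -> T -> 'rV[R]_d) :
  (forall i, bvmeas (F i)) -> bvmeas (fun w => \sum_(i <- s) F i w).
Proof. by move=> bF i; under eq_fun do rewrite summxE; apply: bmeas_sum => j; exact: bF. Qed.

Lemma bmeas_dotv X Y : bvmeas X -> bvmeas Y -> bmeas (fun w => dotv (X w) (Y w)).
Proof. by move=> bX bY; apply: bmeas_sum => i; exact: bmeasM. Qed.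

Lemma bmeas_enorm X : bvmeas X -> bmeas (fun w => enorm (X w)).
Proof. by move=> bX; apply: bmeas_sqrt; exact: bmeas_dotv. Qed.

Lemma bmeas_enorm_sqr X : bvmeas X -> bmeas (fun w => enorm (X w) ^+ 2).
Proof. by move=> bX; apply: bmeasM; exact: bmeas_enorm. Qed.

Lemma bvmeas_le X (K : T -> R) : vmeas X -> bmeas K ->
  (forall w, enorm (X w) <= K w) -> bvmeas X.
Proof.
move=> mX [_ [C KC]] XK i; split; first exact: mX.
exists C => w; apply: (le_trans (normr_coord_le _ _)); apply: (le_trans (XK w)).
exact: (le_trans (ler_norm _)).
Qed.

End bounded_vectors.

Section noise.
Context (R : realType) dz (Zsp : measurableType dz) dO (Omega : measurableType dO)
  (P : probability Omega R) (Q : R.-pker Zsp ~> Zsp) (pi : probability Zsp R)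
  (Z : nat -> Omega -> Zsp) (J : nat -> Omega -> nat) (tau : nat) (d : nat)
  (noise : 'rV[R]_d -> Zsp -> 'rV[R]_d) (S : 'rV[R]_d -> R).
Hypothesis mZ : forall i, measurable_fun setT (Z i).
Hypothesis law : forall (As : seq (set Zsp)) (js : seq nat), mseq As ->
  P [set w | cyl Z As w /\ cylJ J js w]
  = ((\int[pi]_z path_prob Q As z) * (\prod_(j <- js) geom_half j)%:E)%E.
Hypothesis piQ : kernel_invariant Q pi.
Hypothesis tau0 : (0 < tau)%N.
Hypothesis mix : forall (k : nat) (z z' : Zsp),
  half_tv_le (Qpow Q k z) (Qpow Q k z') ((4^-1) ^+ (k %/ tau)).
Hypothesis noise_meas : forall dT (T : measurableType dT) X (Y : T -> Zsp),
  vmeas X -> measurable_fun setT Y -> vmeas (fun w => noise (X w) (Y w)).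
Hypothesis noise_le : forall x z, enorm (noise x z) ^+ 2 <= S x.
Hypothesis noise0 : forall x i, \int[pi]_z noise x z ord0 i = 0.
Hypothesis S_meas : forall dT (T : measurableType dT) (X : T -> 'rV[R]_d),
  bvmeas X -> bmeas (fun w => S (X w)).

Lemma S_ge0 x : 0 <= S x.
Proof. exact: (le_trans (sqr_ge0 _) (noise_le x point)). Qed.

Lemma enorm_noise_le x z : enorm (noise x z) <= Num.sqrt (S x).
Proof. by rewrite -[leLHS](ger0_norm (enorm_ge0 _)) -sqrtr_sqr ler_sqrt ?S_ge0. Qed.

Lemma bvmeas_noise dT (T : measurableType dT) X (Y : T -> Zsp) :
  bvmeas X -> measurable_fun setT Y -> bvmeas (fun w => noise (X w) (Y w)).
Proof.
move=> bX mY; apply: (bvmeas_le (K := fun w => Num.sqrt (S (X w)))).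
- by apply: noise_meas => //; exact: bvmeas_vmeas.
- by apply: bmeas_sqrt; exact: S_meas.
- by move=> w; exact: enorm_noise_le.
Qed.

Lemma measurable_past_mono m m' : (m <= m')%N ->
  measurable_fun setT (fun w : past Z m' => (w : past Z m)).
Proof.
move=> mm'; apply: (measurability (past_gen Z m : set (set (past Z m)))) => //.
move=> _ [_ [As [sA mAs] <-] <-]; apply: sub_sigma_algebra.
exists (As ++ nseq (m' - m) setT).
  split; last by apply: mseq_cat => //; exact: mseq_nseq.
  by rewrite size_cat size_nseq sA addSn subnKC.
by rewrite cyl_cat_setT setTI.
Qed.

Lemma bvmeas_mono m m' (X : Omega -> 'rV[R]_d) : (m <= m')%N ->
  @bvmeas R d _ (past Z m) X -> @bvmeas R d _ (past Z m') X.
Proof. by move=> mm' bX i; exact: (bmeas_comp (measurable_past_mono mm') (bX i)). Qed.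

Lemma bvmeas_past m (X : Omega -> 'rV[R]_d) :
  @bvmeas R d _ (past Z m) X -> bvmeas X.
Proof. by move=> bX i; exact: (bmeas_comp (measurable_to_past mZ (m := m)) (bX i)). Qed.

Lemma noise_mean m k (X U : Omega -> 'rV[R]_d) :
  @bvmeas R d _ (past Z m) X -> @bvmeas R d _ (past Z m) U ->
  \int[P]_w dotv (U w) (noise (X w) (Z (m + k.+1)%N w)) <=
  2 * (4^-1) ^+ (k.+1 %/ tau) * \int[P]_w (enorm (U w) * Num.sqrt (S (X w))).
Proof.
move=> bX bU.
have bX1 : bvmeas (fun x : past Z m * Zsp => X x.1).
  by move=> i; exact: (bmeas_comp measurable_fst (bX i)).
have bU1 : bvmeas (fun x : past Z m * Zsp => U x.1).
  by move=> i; exact: (bmeas_comp measurable_fst (bU i)).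
have bn : bvmeas (fun x : past Z m * Zsp => noise (X x.1) x.2).
  exact: bvmeas_noise.
apply: (@mixing_le _ _ _ _ _ P Q pi Z J tau mZ law piQ mix m k
  (fun x => dotv (U x.1) (noise (X x.1) x.2))
  (fun w => enorm (U w) * Num.sqrt (S (X w)))).
- exact: bmeas_dotv.
- apply: bmeasM; first exact: bmeas_enorm.
  by apply: bmeas_sqrt; exact: S_meas.
- move=> w y /=; apply: (le_trans (normr_dotv_le _ _)).
  by rewrite ler_wpM2l ?enorm_ge0// enorm_noise_le.
- move=> w /=; have bnw : bvmeas (fun y => noise (X w) y).
    by apply: (@bvmeas_noise _ _ (fun=> X w)) => //; exact: bvmeas_cst.
  rewrite exp_sum; last by move=> i; apply: bmeasZ; exact: bnw.
  by rewrite big1// => i _; rewrite expZ ?noise0 ?mulr0//; exact: bnw.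
Qed.

Definition noise_sum (m n : nat) (X : Omega -> 'rV[R]_d) (w : Omega) : 'rV[R]_d :=
  \sum_(i < n) noise (X w) (Z (m + i.+1)%N w).

Lemma bvmeas_noise_sum m n (X : Omega -> 'rV[R]_d) :
  bvmeas X -> bvmeas (noise_sum m n X).
Proof. by move=> bX; apply: bvmeas_sum => i; exact: bvmeas_noise. Qed.

(** [8 / 3] is the factor 2 of [noise_mean] times the [4 / 3] of [sum_geom_blocks]. The lags start
    at 1, so the lag 0 term of the latter sum is discarded. *)
Lemma noise_sum_mean m n (X U : Omega -> 'rV[R]_d) :
  @bvmeas R d _ (past Z m) X -> @bvmeas R d _ (past Z m) U ->
  \int[P]_w dotv (U w) (noise_sum m n X w) <=
  8 / 3 * tau%:R * \int[P]_w (enorm (U w) * Num.sqrt (S (X w))).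
Proof.
move=> bX bU.
have bX' := bvmeas_past bX; have bU' := bvmeas_past bU.
under eq_Rintegral do rewrite dotv_sumr.
rewrite exp_sum; last by move=> i; apply: bmeas_dotv => //; exact: bvmeas_noise.
set E := \int[P]_w (enorm _ * _).
have E0 : 0 <= E by apply: exp_ge0 => w; rewrite mulr_ge0 ?enorm_ge0 ?sqrtr_ge0.
apply: (@le_trans _ _ (\sum_(i < n) 2 * (4^-1) ^+ (i.+1 %/ tau) * E)).
  by apply: ler_sum => i _; exact: noise_mean.
rewrite -mulr_suml -mulr_sumr ler_wpM2r//.
have := sum_geom_blocks R n.+1 tau0.
rewrite big_ord_recl/= => h.
have : 0 <= (4^-1 : R) ^+ (0 %/ tau) by rewrite exprn_ge0.
move: h; under [X in _ + X]eq_bigr do rewrite /bump/= add1n.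
lra.
Qed.

(** One more state adds a diagonal term and twice its correlation with the earlier ones: at most
    [1 + 2 * (8 / 3) * tau <= 19 / 3 * tau] times the mean of [S]. *)
Lemma noise_sum_sqr m n (X : Omega -> 'rV[R]_d) :
  @bvmeas R d _ (past Z m) X ->
  \int[P]_w (enorm (noise_sum m n X w) ^+ 2) <=
  19 / 3 * tau%:R * n%:R * \int[P]_w S (X w).
Proof.
move=> bX.
have bX' := bvmeas_past bX.
set E := \int[P]_w S (X w).
have E0 : 0 <= E by apply: exp_ge0 => w; exact: S_ge0.
elim: n => [|n IH].
  rewrite mulr0 mul0r; under eq_Rintegral.
    move=> w _; rewrite /noise_sum big_ord0 enorm_sqr -(scale0r (0 : 'rV[R]_d)) dotvZl mul0r.
    over.
  by rewrite exp_cst.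
pose e w := noise (X w) (Z (m + n.+1)%N w).
have be : bvmeas e by exact: bvmeas_noise.
have bs k : bvmeas (noise_sum m k X) by exact: bvmeas_noise_sum.
have -> : \int[P]_w (enorm (noise_sum m n.+1 X w) ^+ 2) =
    \int[P]_w (enorm (noise_sum m n X w) ^+ 2 + 2 * dotv (noise_sum m n X w) (e w)
               + enorm (e w) ^+ 2).
  by apply: eq_Rintegral => w _; rewrite /noise_sum big_ord_recr enorm_sqrD.
have bdot := bmeas_dotv (bs n) be.
rewrite expD; [|apply: bmeasD; [exact: bmeas_enorm_sqr|exact: bmeasZ]|exact: bmeas_enorm_sqr].
rewrite expD; [|exact: bmeas_enorm_sqr|exact: bmeasZ].
rewrite expZ//.
have he : \int[P]_w (enorm (e w) ^+ 2) <= E.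
  apply: exp_le; [exact: bmeas_enorm_sqr|exact: S_meas|].
  by move=> w; exact: noise_le.
have hd : \int[P]_w dotv (noise_sum m n X w) (e w) <= 8 / 3 * tau%:R * E.
  under eq_Rintegral do rewrite dotv_suml.
  rewrite exp_sum; last by move=> i; apply: bmeas_dotv => //; exact: bvmeas_noise.
  apply: (@le_trans _ _ (\sum_(i < n) 2 * (4^-1) ^+ ((n - i) %/ tau) * E)).
    apply: ler_sum => i _.
    (* The [i]-th noise term is known at time [m + i.+1], so it can play the part of [U] in
       [noise_mean], at lag [n - i]. *)
    have bXi : @bvmeas R d _ (past Z (m + i.+1)) X.
      by apply: bvmeas_mono bX; exact: leq_addr.
    have bei : @bvmeas R d _ (past Z (m + i.+1)) (fun w => noise (X w) (Z (m + i.+1)%N w)).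
      by apply: bvmeas_noise => //; exact: measurable_past_Z.
    have := noise_mean (n - i.+1) bXi bei.
    rewrite subnSK//; have -> : (m + i.+1 + (n - i) = m + n.+1)%N.
      by rewrite -addnA addSn subnKC// ltnW.
    move=> h; apply: (le_trans h).
    rewrite ler_wpM2l// ?mulr_ge0 ?exprn_ge0//.
    apply: exp_le.
    - apply: bmeasM; first exact: bmeas_enorm (bvmeas_past bei).
      by apply: bmeas_sqrt; exact: S_meas.
    - exact: S_meas.
    - move=> w; rewrite -[leRHS](sqr_sqrtr (S_ge0 _)) expr2 ler_wpM2r ?sqrtr_ge0//.
      exact: enorm_noise_le.
  rewrite -mulr_suml -mulr_sumr ler_wpM2r//.
  rewrite (reindex_inj rev_ord_inj)/=.
  have := sum_geom_blocks R n.+1 tau0.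
  rewrite big_ord_recl/= => h.
  have : 0 <= (4^-1 : R) ^+ (0 %/ tau) by rewrite exprn_ge0.
  move: h; under [X in _ + X]eq_bigr do rewrite /bump/= add1n.
  under [X in _ -> _ -> 2 * X <= _]eq_bigr do rewrite subKn//.
  lra.
have t1 : 1 <= tau%:R :> R by rewrite ler1n.
have t2 := ler_wpM2r E0 t1.
rewrite -natr1; move: IH hd he t2; lra.
Qed.

End noise.

Section mlmc_weights.
Variable R : realType.

(** Nonnegativity allows the partial sum to be extended past [l], where the bound is constant and
    the levels weigh at most [2^-1 ^+ l] in total. Level 0 has weight 0, hence the restriction to
    positive [j]. *)
Lemma geom_sum_le (l n : nat) (a U : nat -> R) (Uoo : R) :
  (forall j, (0 < j)%N -> 0 <= a j) -> (forall j, (0 < j)%N -> a j <= U j) ->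
  (forall j, (l < j)%N -> U j = Uoo) ->
  \sum_(j < n) geom_half j * a j <=
  \sum_(j < l.+1) geom_half j * U j + 2^-1 ^+ l * Uoo.
Proof.
move=> a0 aU Ul.
have g0 j : 0 <= geom_half j :> R.
  by rewrite /geom_half; case: ifP => // _; rewrite invr_ge0 exprn_ge0.
have gaU j : geom_half j * a j <= geom_half j * U j.
  by case: j => [|j]; [rewrite /geom_half/= !mul0r|rewrite ler_wpM2l// aU].
have gU0 j : 0 <= geom_half j * U j.
  case: j => [|j]; first by rewrite /geom_half/= mul0r.
  by rewrite mulr_ge0// (le_trans (a0 _ _) (aU _ _)).
apply: (@le_trans _ _ (\sum_(j < n) geom_half j * U j)).
  by apply: ler_sum => j _; exact: gaU.
apply: (@le_trans _ _ (\sum_(j < l.+1 + n) geom_half j * U j)).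
  rewrite addnC big_split_ord/= lerDl; apply: sumr_ge0 => j _; exact: gU0.
rewrite big_split_ord/= lerD2l.
under eq_bigr do rewrite Ul ?ltnS ?leq_addr//.
rewrite -mulr_suml ler_wpM2r//.
  by rewrite -(Ul l.+1)// (le_trans (a0 l.+1 _) (aU _ _)).
have := geom_sum_tail R l n; rewrite big_split_ord/=.
have := geom_sum_tail R l 0; rewrite big_split_ord/= big_ord0 !addr0 addn0 => -> h.
have : 0 <= (2^-1 : R) ^+ (l + n) by rewrite exprn_ge0.
move: h; lra.
Qed.

(* [bt j] and [v] stand for the mean of a linear functional and of the squared
   norm of the level [j] error; the linear part telescopes, and each of the
   [l] corrections contributes the same amount to the second moment. *)
Lemma mlmc_weights (l : nat) (A c v : R) (bt W D : nat -> R) :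
  (0 < l)%N -> 0 <= c -> 0 <= v ->
  (forall j, (0 < j <= l)%N -> W j = bt 0%N + 2 ^+ j * (bt j - bt j.-1)) ->
  (forall j, (0 < j <= l)%N -> D j <= 2 * v + 12 * 2 ^+ j * v) ->
  \sum_(j < l.+1) geom_half j * (A + W j + c * D j) + 2^-1 ^+ l * (A + bt 0%N + c * v)
  <= A + bt l + c * (14 * (l%:R * v)).
Proof.
move=> l0 c0 v0 WE DE.
(* Invariant for the cut-off [k]: weight [2^-1 ^+ k] still sits on the plain level 0 estimator.
   Raising [k] moves half of it to the corrected one, which turns [bt k] into [bt k.+1] and adds
   [12 * v] for the correction. *)
have claim k : (k <= l)%N ->
  \sum_(j < k.+1) geom_half j * (A + W j + c * D j) + 2^-1 ^+ k * (A + bt 0%N + c * v)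
  <= A + bt k + c * ((2 - 2^-1 ^+ k) * v + 12 * k%:R * v).
  elim: k => [|k IH] kl.
    by rewrite big_ord1 /geom_half/= expr0; rewrite le_eqVlt; apply/orP; left; apply/eqP; ring.
  have {}IH := IH (ltnW kl).
  have gE : geom_half k.+1 = (2^-1 : R) ^+ k.+1 by rewrite /geom_half exprVn.
  have nE : k.+1%:R = k%:R + 1 :> R by rewrite natr1.
  rewrite big_ord_recr/= gE WE ?kl//= nE.
  have Dk := DE k.+1 kl.
  have e0 : 0 < (2^-1 : R) ^+ k.+1 by rewrite exprn_gt0.
  have e2 : (2^-1 : R) ^+ k = 2 * 2^-1 ^+ k.+1 by rewrite exprS; field.
  have e1 : (2^-1 : R) ^+ k.+1 * 2 ^+ k.+1 = 1 by rewrite -exprMn mulVf ?expr1n.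
  move: IH Dk e0 e1; rewrite e2.
  set t := (2^-1 : R) ^+ k.+1; set s := (2 : R) ^+ k.+1.
  move=> IH Dk t0 ts.
  have := ler_wpM2l (mulr_ge0 c0 (ltW t0)) Dk.
  have := congr1 (fun z => z * (bt k.+1 - bt k)) ts.
  have := congr1 (fun z => z * (c * v)) ts.
  move: IH; clear; lra.
apply: (le_trans (claim l (leqnn l))).
(* Origin of 14: [2 + 12 * l <= 14 * l] for positive [l]. *)
rewrite lerD2l ler_wpM2l//.
have : 1 <= l%:R :> R by rewrite ler1n.
have : 0 <= (2^-1 : R) ^+ l by rewrite exprn_ge0.
move=> h1 /(ler_wpM2r v0); have := mulr_ge0 h1 v0; lra.
Qed.

(** Used with [t = 2^-1 ^+ j], [f = 4 ^+ j], [s = 2 ^+ j] and [e0], [e1], [e2] the second moments at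
    levels 0, [j], [j.-1]. Splitting a square of a sum twice gives [2 * 2 * (1 + 2) = 12]. *)
Lemma level_combine (e0 e1 e2 v t f s : R) : e0 <= v -> e1 <= t * v ->
  e2 <= 2 * t * v -> f * t = s -> 0 <= f ->
  2 * e0 + 2 * f * (2 * e1 + 2 * e2) <= 2 * v + 12 * s * v.
Proof.
move=> h0 h1 h2 <- f0.
have := ler_wpM2l f0 h1; have := ler_wpM2l f0 h2; move: h0; clear; lra.
Qed.
End mlmc_weights.

Section mlmc.
Context (R : realType) dz (Zsp : measurableType dz) dO (Omega : measurableType dO)
  (P : probability Omega R) (Q : R.-pker Zsp ~> Zsp) (pi : probability Zsp R)
  (Z : nat -> Omega -> Zsp) (J : nat -> Omega -> nat) (tau : nat) (d : nat)
  (gradF : 'rV[R]_d -> Zsp -> 'rV[R]_d) (gradf : 'rV[R]_d -> 'rV[R]_d)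
  (S : 'rV[R]_d -> R) (M : R) (B l : nat).
Let noise x z := gradF x z - gradf x.
Hypothesis mZ : forall i, measurable_fun setT (Z i).
Hypothesis law : forall (As : seq (set Zsp)) (js : seq nat), mseq As ->
  P [set w | cyl Z As w /\ cylJ J js w]
  = ((\int[pi]_z path_prob Q As z) * (\prod_(j <- js) geom_half j)%:E)%E.
Hypothesis piQ : kernel_invariant Q pi.
Hypothesis tau0 : (0 < tau)%N.
Hypothesis mix : forall (k : nat) (z z' : Zsp),
  half_tv_le (Qpow Q k z) (Qpow Q k z') ((4^-1) ^+ (k %/ tau)).
Hypothesis noise_meas : forall dT (T : measurableType dT) X (Y : T -> Zsp),
  vmeas X -> measurable_fun setT Y -> vmeas (fun w => noise (X w) (Y w)).
Hypothesis noise_le : forall x z, enorm (noise x z) ^+ 2 <= S x.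
Hypothesis noise0 : forall x i, \int[pi]_z noise x z ord0 i = 0.
Hypothesis S_meas : forall dT (T : measurableType dT) (X : T -> 'rV[R]_d),
  bvmeas X -> bmeas (fun w => S (X w)).
Hypothesis l0 : (0 < l)%N.
Hypothesis Ml : (2 ^ l)%N%:R <= M.
Hypothesis Ml1 : M < (2 ^ l.+1)%N%:R.
Hypothesis B0 : (0 < B)%N.

Variables (m : nat) (X : Omega -> 'rV[R]_d).
Hypothesis bX : @bvmeas R d _ (past Z m) X.

Definition level_err (j : nat) (w : Omega) : 'rV[R]_d :=
  (2 ^- j / B%:R) *: noise_sum Z noise m (2 ^ j * B) X w.

Definition mlmc_err (j : nat) (w : Omega) : 'rV[R]_d :=
  if (2 ^ j)%N%:R <= M then
    level_err 0 w + (2 ^ j)%N%:R *: (level_err j w - level_err j.-1 w)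
  else level_err 0 w.

Let n0 j : (0 < 2 ^ j * B)%N. Proof. by rewrite muln_gt0 expn_gt0 B0. Qed.

Let coefE j : 2 ^- j / B%:R = ((2 ^ j * B)%N%:R)^-1 :> R.
Proof. by rewrite natrM natrX invfM. Qed.

Lemma mlmc_levelE j w :
  mlmc_level B gradF (fun i => Z i w) m (X w) j = gradf (X w) + level_err j w.
Proof.
rewrite /mlmc_level /level_err coefE /noise_sum.
under eq_bigr do rewrite -[gradF _ _](subrK (gradf (X w))) -/(noise _ _).
rewrite big_split/= scalerDr addrC; congr (_ + _).
rewrite sumr_const card_ord -[gradf _ *+ _]scaler_nat scalerA mulVf ?scale1r//.
by rewrite pnatr_eq0 -lt0n.
Qed.

Lemma mlmc_gradE j w :
  mlmc_grad M B gradF (fun i => Z i w) m (X w) j = gradf (X w) + mlmc_err j w.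
Proof.
rewrite /mlmc_grad /mlmc_err !mlmc_levelE; case: ifP => // _.
by rewrite -addrA opprD addrACA subrr add0r.
Qed.

Let bX' := bvmeas_past mZ bX.

Lemma bvmeas_level_err j : bvmeas (level_err j).
Proof. by apply: bvmeasZ; exact: (bvmeas_noise_sum mZ noise_meas noise_le S_meas). Qed.

Lemma bvmeas_mlmc_err j : bvmeas (mlmc_err j).
Proof.
have [h|h] := boolP ((2 ^ j)%N%:R <= M).
  have -> : mlmc_err j = fun w =>
      level_err 0 w + (2 ^ j)%N%:R *: (level_err j w - level_err j.-1 w).
    by apply/funext => w; rewrite /mlmc_err h.
  apply: bvmeasD; first exact: bvmeas_level_err.
  by apply: bvmeasZ; apply: bvmeasB; exact: bvmeas_level_err.
have -> : mlmc_err j = level_err 0.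
  by apply/funext => w; rewrite /mlmc_err (negPf h).
exact: bvmeas_level_err.
Qed.

Lemma level_err_sqr j : \int[P]_w (enorm (level_err j w) ^+ 2) <=
  2^-1 ^+ j * (19 / 3 * tau%:R / B%:R * \int[P]_w S (X w)).
Proof.
have bs := bvmeas_noise_sum mZ noise_meas noise_le S_meas m (2 ^ j * B) bX'.
under eq_Rintegral do rewrite /level_err enormZ exprMn.
rewrite expZ; last exact: bmeas_enorm_sqr.
rewrite real_normK ?num_real//.
have := noise_sum_sqr mZ law piQ tau0 mix noise_meas noise_le noise0 S_meas (2 ^ j * B) bX.
move=> /(ler_wpM2l (sqr_ge0 (2 ^- j / B%:R))) h; apply: (le_trans h).
rewrite le_eqVlt; apply/orP; left; apply/eqP.
rewrite exprVn natrM natrX; field.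
by rewrite pnatr_eq0 -lt0n B0 expf_neq0// pnatr_eq0.
Qed.

Lemma level_err_mean j (U : Omega -> 'rV[R]_d) : @bvmeas R d _ (past Z m) U ->
  \int[P]_w dotv (U w) (level_err j w) <=
  8 / 3 * tau%:R / (2 ^+ j * B%:R) * \int[P]_w (enorm (U w) * Num.sqrt (S (X w))).
Proof.
move=> bU.
have bs := bvmeas_noise_sum mZ noise_meas noise_le S_meas m (2 ^ j * B) bX'.
under eq_Rintegral do rewrite /level_err dotvZr.
rewrite expZ; last by apply: bmeas_dotv => //; exact: (bvmeas_past mZ bU).
have := noise_sum_mean mZ law piQ tau0 mix noise_meas noise_le noise0 S_meas (2 ^ j * B) bX bU.
have c0 : 0 <= 2 ^- j / B%:R :> R by rewrite divr_ge0// invr_ge0 exprn_ge0.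
move=> /(ler_wpM2l c0) h; apply: (le_trans h).
rewrite le_eqVlt; apply/orP; left; apply/eqP; field.
by rewrite pnatr_eq0 -lt0n B0 expf_neq0// pnatr_eq0.
Qed.

Lemma level_le_M j : ((2 ^ j)%N%:R <= M) = (j <= l)%N.
Proof.
apply/idP/idP => [h|jl]; last first.
  by apply: le_trans Ml; rewrite ler_nat leq_exp2l.
have := le_lt_trans h Ml1; rewrite ltr_nat ltn_exp2l//.
Qed.

(** [a j] is the expected potential after a step at level [j], and [A] the part free of the gradient
    error. All levels above [l] fall back on level 0, which is the constant tail needed by
    [geom_sum_le]. *)
Lemma mlmc_mean (n : nat) (A c : R) (U : Omega -> 'rV[R]_d) (a : nat -> R) :
  bvmeas U -> 0 <= c ->
  (forall j, 0 <= a j) ->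
  (forall j, (0 < j)%N -> a j <= A + \int[P]_w dotv (U w) (mlmc_err j w)
     + c * \int[P]_w (enorm (mlmc_err j w) ^+ 2)) ->
  \sum_(j < n) geom_half j * a j <=
  A + \int[P]_w dotv (U w) (level_err l w)
  + c * (14 * (l%:R * (19 / 3 * tau%:R / B%:R * \int[P]_w S (X w)))).
Proof.
move=> bU c0 a0 aU.
set v := 19 / 3 * tau%:R / B%:R * \int[P]_w S (X w).
have v0 : 0 <= v.
  apply: mulr_ge0; last by apply: exp_ge0 => w; exact: (S_ge0 noise_le).
  by rewrite !mulr_ge0 ?invr_ge0.
pose bt j := \int[P]_w dotv (U w) (level_err j w).
pose W j := \int[P]_w dotv (U w) (mlmc_err j w).
pose D j := \int[P]_w (enorm (mlmc_err j w) ^+ 2).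
have V j : \int[P]_w (enorm (level_err j w) ^+ 2) <= 2^-1 ^+ j * v by exact: level_err_sqr.
apply: (le_trans (@geom_sum_le _ l n a (fun j => A + W j + c * D j)
  (A + bt 0%N + c * \int[P]_w (enorm (level_err 0 w) ^+ 2)) _ _ _)).
- by move=> j _; exact: a0.
- exact: aU.
- move=> j lj; rewrite /W /D /bt /mlmc_err.
  by under eq_Rintegral do rewrite level_le_M leqNgt lj /=;
     under [X in _ + _ * X]eq_Rintegral do rewrite level_le_M leqNgt lj /=.
have V0 : \int[P]_w (enorm (level_err 0 w) ^+ 2) <= v by have := V 0%N; rewrite expr0 mul1r.
apply: (@le_trans _ _ (\sum_(j < l.+1) geom_half j * (A + W j + c * D j)
  + 2^-1 ^+ l * (A + bt 0%N + c * v))).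
  by rewrite lerD2l ler_wpM2l ?exprn_ge0// lerD2l ler_wpM2l.
apply: mlmc_weights => //.
- move=> j /andP[j0 jl]; rewrite /W /bt /mlmc_err.
  under eq_Rintegral do rewrite level_le_M jl dotvDr dotvZr dotvBr.
  have b j' : bmeas (fun w => dotv (U w) (level_err j' w)).
    by apply: bmeas_dotv => //; exact: bvmeas_level_err.
  by rewrite expD ?expZ ?expB ?natrX//; [exact: bmeasB|apply: bmeasZ; exact: bmeasB].
- move=> j /andP[j0 jl]; rewrite /D.
  have b j' : bmeas (fun w => enorm (level_err j' w) ^+ 2).
    by apply: bmeas_enorm_sqr; exact: bvmeas_level_err.
  apply: (@le_trans _ _ (\int[P]_w (2 * enorm (level_err 0 w) ^+ 2 + 2 * 4 ^+ j *
     (2 * enorm (level_err j w) ^+ 2 + 2 * enorm (level_err j.-1 w) ^+ 2)))).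
    apply: exp_le.
    + by apply: bmeas_enorm_sqr; exact: bvmeas_mlmc_err.
    + by apply: bmeasD; apply: bmeasZ => //; apply: bmeasD; exact: bmeasZ.
    move=> w; rewrite /mlmc_err level_le_M jl.
    apply: (le_trans (enorm_sqrD_le _ _)); rewrite lerD2l enormZ exprMn.
    rewrite real_normK ?num_real// natrX -exprM mulnC exprM -mulrA.
    rewrite (_ : 2 ^+ 2 = 4 :> R); last by ring.
    rewrite ler_wpM2l// ler_wpM2l ?exprn_ge0//.
    by rewrite -[X in _ <= _ + 2 * X ^+ 2]enormN; exact: enorm_sqrD_le.
  rewrite expD; [|exact: bmeasZ|by apply: bmeasZ; apply: bmeasD; exact: bmeasZ].
  rewrite !expZ//; last by apply: bmeasD; exact: bmeasZ.
  rewrite expD; [|exact: bmeasZ|exact: bmeasZ].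
  rewrite !expZ//.
  have Vj := V j; have Vj1 := V j.-1.
  have e2 : (2^-1 : R) ^+ j.-1 = 2 * 2^-1 ^+ j.
    by rewrite -{2}(prednK j0) exprS; field.
  have e4 : (4 : R) ^+ j * 2^-1 ^+ j = 2 ^+ j.
    by rewrite -exprMn; congr (_ ^+ _); field.
  have f0 : 0 <= (4 : R) ^+ j by rewrite exprn_ge0.
  have Vj1' := Vj1; rewrite e2 in Vj1'.
  exact: level_combine V0 Vj Vj1' e4 f0.
Qed.

End mlmc.

(** * The recursion in expectation *)

Section scalar_steps.
Variable R : realType.

Lemma step_size_le1 (p gamma L k : R) : 0 < p -> 0 < gamma -> 0 < L -> 0 <= k ->
  p * (2 * (1 + gamma * L) * (1 + 4 * k)) <= 1 -> p * (1 + 2 * L * gamma) <= 1.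
Proof.
move=> p0 g0 L0 k0 hp.
have h1 : 0 < p * (gamma * L) by rewrite !mulr_gt0.
have h2 : 0 <= p * k by apply: mulr_ge0 => //; exact: ltW.
have h3 : 0 <= p * (gamma * L) * k by apply: mulr_ge0 => //; exact: ltW.
lra.
Qed.

(** With [a1], [a2], [a3] the squared norms of [x - xs], [xg - xs], [x - xg], the potential can
    afford the [beta / 2 * r ^+ 2] of [noise_budget]: [(1 - beta) * (1 + beta / 2) <= 1 - beta / 2],
    and the coefficient [beta ^+ 2 / 2 - beta / 2] of [a2] is nonpositive. *)
Lemma step_combine (beta eta p gamma c q kap kap1 a1 a2 a3 F r n S s T : R) :
  0 < beta -> beta <= 1 -> 0 <= a1 -> 0 <= a2 -> 0 <= a3 ->
  c * n ^+ 2 - 2 * q * n ^+ 2 + c * (kap * S)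
    + 2 * eta * p * gamma * (r * (kap1 * s)) + 2 * q * (n * (kap1 * s))
  <= beta / 2 * r ^+ 2 + T ->
  0 <= c * (n * (kap1 * s)) ->
  r ^+ 2 = (1 - beta) * a1 + beta * a2 - beta * (1 - beta) * a3 ->
  (1 - beta) * a1 + (1 - beta / 2) * F - beta / 2 * a2 - beta * (1 - beta) * a3
    + (c - 2 * q) * n ^+ 2 + 2 * eta * p * gamma * (kap1 * (r * s))
    + (2 * q - 2 * c) * (kap1 * (n * s)) + c * (kap * S)
  <= (1 - beta / 2) * (a1 + F) + T.
Proof.
move=> b0 b1 a10 a20 a30 nb ns0 rE.
have b1' : 0 <= 1 - beta by rewrite subr_ge0.
have g1 := mulr_ge0 (mulr_ge0 (ltW b0) b1') a30.
have g2 := mulr_ge0 (mulr_ge0 (ltW b0) (ltW b0)) a10.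
have g3 := mulr_ge0 (mulr_ge0 (ltW b0) b1') a20.
have g4 := mulr_ge0 (ltW b0) g1.
have yb := congr1 (fun z => beta * z) rE.
move: nb ns0 yb g1 g2 g3 g4 => /=; clear; lra.
Qed.
End scalar_steps.

Section expected_step.
Context (R : realType) dz (Zsp : measurableType dz) dO (Omega : measurableType dO)
  (P : probability Omega R) (Q : R.-pker Zsp ~> Zsp) (pi : probability Zsp R)
  (Z : nat -> Omega -> Zsp) (J : nat -> Omega -> nat) (tau : nat) (d : nat)
  (f : 'rV[R]_d -> R)
  (gradF : 'rV[R]_d -> Zsp -> 'rV[R]_d) (gradf : 'rV[R]_d -> 'rV[R]_d)
  (xs : 'rV[R]_d) (L mu sigma delta gamma p beta eta theta K M : R) (B l : nat).
(* [K] is the bracket [C1 tau / b + (C1 + 1) tau ^ 2 / b ^ 2] of the paper, [l] the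
   last level with [2 ^ l <= M]; [hkap] and [hkap1] are all that is used of the
   choice of [M] and [B]. *)
Let noise x z := gradF x z - gradf x.
Let S x := sigma ^+ 2 + delta ^+ 2 * enorm (gradf x) ^+ 2.
Hypothesis mZ : forall i, measurable_fun setT (Z i).
Hypothesis mJ : forall k j, measurable [set w | J k w = j].
Hypothesis law : forall (As : seq (set Zsp)) (js : seq nat), mseq As ->
  P [set w | cyl Z As w /\ cylJ J js w]
  = ((\int[pi]_z path_prob Q As z) * (\prod_(j <- js) geom_half j)%:E)%E.
Hypothesis piQ : kernel_invariant Q pi.
Hypothesis tau0 : (0 < tau)%N.
Hypothesis mix : forall (k : nat) (z z' : Zsp),
  half_tv_le (Qpow Q k z) (Qpow Q k z') ((4^-1) ^+ (k %/ tau)).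
Hypothesis gradF_meas : forall dT (T : measurableType dT) X (Y : T -> Zsp),
  vmeas X -> measurable_fun setT Y -> vmeas (fun w => gradF (X w) (Y w)).
Hypothesis gradf_meas : forall dT (T : measurableType dT) (X : T -> 'rV[R]_d),
  vmeas X -> vmeas (fun w => gradf (X w)).
Hypothesis f_meas : forall dT (T : measurableType dT) (X : T -> 'rV[R]_d),
  vmeas X -> measurable_fun setT (fun w => f (X w)).
Hypothesis noise_le : forall x z, enorm (noise x z) ^+ 2 <= S x.
Hypothesis noise0 : forall x i, \int[pi]_z noise x z ord0 i = 0.
Hypothesis l0 : (0 < l)%N.
Hypothesis Ml : (2 ^ l)%N%:R <= M.
Hypothesis Ml1 : M < (2 ^ l.+1)%N%:R.
Hypothesis B0 : (0 < B)%N.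
Hypothesis Lip : forall x y, enorm (gradf x - gradf y) <= L * enorm (x - y).
Hypothesis scvx : forall x y,
  f x - f y - dotv (gradf y) (x - y) >= mu / 2 * enorm (x - y) ^+ 2.
Hypothesis fmin : forall x, f xs <= f x.
Hypothesis L0 : 0 < L.
Hypothesis mu0 : 0 < mu.
Hypothesis gamma0 : 0 < gamma.
Hypothesis u34 : gamma * L <= 3 / 4.
Hypothesis p0 : 0 < p.
Hypothesis eta0 : 0 < eta.
Hypothesis p_eta : p <= eta.
Hypothesis beta0 : 0 < beta.
Hypothesis beta1 : beta <= 1.
Hypothesis eta2 : eta ^+ 2 * (mu * gamma) = 3.
Hypothesis betaE : beta * 3 = 2 * eta * gamma * p * mu.
Hypothesis beta_eta : beta / 2 = p / eta.
Hypothesis thetaE : theta * (eta - beta * p) = eta - p.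
Hypothesis K0 : 0 <= K.
Hypothesis hp : p * (2 * (1 + gamma * L) * (1 + 4 * K * delta ^+ 2)) <= 1.
Hypothesis hkap : 14 * (l%:R * (19 / 3 * tau%:R / B%:R)) <= 111 / 20 * K.
Hypothesis hkap1 : (8 / 3 * tau%:R / (2 ^+ l * B%:R)) ^+ 2 * (1 + 2 * p / beta)
  <= p * K / 51.

Lemma bvmeas_gradf dT (T : measurableType dT) (X : T -> 'rV[R]_d) :
  bvmeas X -> bvmeas (fun w => gradf (X w)).
Proof.
move=> bX.
have -> : (fun w => gradf (X w)) = (fun w => (gradf (X w) - gradf xs) + gradf xs).
  by apply/funext => w; rewrite subrK.
apply: bvmeasD; last exact: bvmeas_cst.
apply: (bvmeas_le (K := fun w => L * enorm (X w - xs))).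
- move=> i; under eq_fun do rewrite !mxE.
  apply: measurable_funB; last exact: measurable_cst.
  by apply: gradf_meas; exact: bvmeas_vmeas.
- by apply: bmeasZ; apply: bmeas_enorm; apply: bvmeasB => //; exact: bvmeas_cst.
- by move=> w; exact: Lip.
Qed.

(** Bounded below by the minimum, and above by convexity, since the gradient is bounded along a
    bounded [X]. *)
Lemma bmeas_f dT (T : measurableType dT) (X : T -> 'rV[R]_d) :
  bvmeas X -> bmeas (fun w => f (X w)).
Proof.
move=> bX; split; first by apply: f_meas; exact: bvmeas_vmeas.
have bXs : bvmeas (fun w => X w - xs) by apply: bvmeasB => //; exact: bvmeas_cst.
have [_ [C hC]] : bmeas (fun w => `|f xs| + dotv (gradf (X w)) (X w - xs)).
  apply: bmeasD; first exact: bmeas_cst.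
  by apply: bmeas_dotv => //; exact: bvmeas_gradf.
exists (C + `|f xs|) => w; have := hC w; have := fmin (X w).
have := scvx xs (X w); rewrite -[xs - X w]opprB dotvNr.
have : 0 <= mu / 2 * enorm (- (X w - xs)) ^+ 2.
  by apply: mulr_ge0; [apply: divr_ge0; rewrite ?ltW|exact: sqr_ge0].
have := ler_norm (f xs); have := ler_norm (- f xs); rewrite normrN.
have := ler_norm (`|f xs| + dotv (gradf (X w)) (X w - xs)).
move=> h1 h2 h3 h4 h5 h6 h7.
by rewrite ler_norml; apply/andP; split; lra.
Qed.

Lemma S_meas dT (T : measurableType dT) (X : T -> 'rV[R]_d) :
  bvmeas X -> bmeas (fun w => S (X w)).
Proof.
move=> bX; apply: bmeasD; first exact: bmeas_cst.
by apply: bmeasZ; apply: bmeas_enorm_sqr; exact: bvmeas_gradf.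
Qed.

Lemma noise_meas dT (T : measurableType dT) X (Y : T -> Zsp) :
  vmeas X -> measurable_fun setT Y -> vmeas (fun w => noise (X w) (Y w)).
Proof.
move=> mX mY i; under eq_fun do rewrite !mxE.
by apply: measurable_funB; [exact: gradF_meas|exact: gradf_meas].
Qed.

Definition potential (s : 'rV[R]_d * 'rV[R]_d * nat) : R :=
  enorm (s.1.1 - xs) ^+ 2 + 6 / mu * (f s.1.2 - f xs).

Lemma potential_ge0 s : 0 <= potential s.
Proof.
apply: addr_ge0; first exact: sqr_ge0.
by apply: mulr_ge0; [apply: divr_ge0; rewrite ?ltW|rewrite subr_ge0].
Qed.

Lemma bmeas_potential dT (T : measurableType dT)
    (s : T -> 'rV[R]_d * 'rV[R]_d * nat) :
  bvmeas (fun w => (s w).1.1) -> bvmeas (fun w => (s w).1.2) ->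
  bmeas (fun w => potential (s w)).
Proof.
move=> b1 b2; apply: bmeasD.
  by apply: bmeas_enorm_sqr; apply: bvmeasB => //; exact: bvmeas_cst.
by apply: bmeasZ; apply: bmeasB; [exact: bmeas_f|exact: bmeas_cst].
Qed.

Lemma bvmeas_gradF dT (T : measurableType dT) X (Y : T -> Zsp) :
  bvmeas X -> measurable_fun setT Y -> bvmeas (fun w => gradF (X w) (Y w)).
Proof.
move=> bX mY.
have -> : (fun w => gradF (X w) (Y w)) = (fun w => noise (X w) (Y w) + gradf (X w)).
  by apply/funext => w; rewrite /noise subrK.
apply: bvmeasD; last exact: bvmeas_gradf.
exact: (bvmeas_noise noise_meas noise_le S_meas).
Qed.

(** Stated over any space and for states up to the end of the window, so that it applies on [Omega]
    and on the past at the end of the step. *)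
Lemma bvmeas_ragd_step dT (T : measurableType dT) (Zs : nat -> T -> Zsp) (m j : nat)
    (X0 Xf : T -> 'rV[R]_d) :
  (forall i, (i <= m + 2 ^ j * B)%N -> measurable_fun setT (Zs i)) ->
  bvmeas X0 -> bvmeas Xf ->
  let step w := ragd_step gamma theta eta beta p M B gradF
    (fun i => Zs i w) j (X0 w, Xf w, m) in
  bvmeas (fun w => (step w).1.1) /\ bvmeas (fun w => (step w).1.2).
Proof.
move=> mZs bX0 bXf /=.
have bXg : bvmeas (fun w => theta *: Xf w + (1 - theta) *: X0 w).
  by apply: bvmeasD; exact: bvmeasZ.
set Xg := fun w => _ in bXg.
have blevel k : (k <= j)%N ->
    bvmeas (fun w => mlmc_level B gradF (fun i => Zs i w) m (Xg w) k).
  move=> kj; apply: bvmeasZ; apply: bvmeas_sum => i; apply: bvmeas_gradF => //.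
  apply: mZs; rewrite leq_add2l; apply: (leq_trans (ltn_ord i)).
  by rewrite leq_mul2r leq_exp2l// kj orbT.
have bgrad : bvmeas (fun w => mlmc_grad M B gradF (fun i => Zs i w) m (Xg w) j).
  rewrite /mlmc_grad; have [h|h] := boolP ((2 ^ j)%N%:R <= M).
    apply: bvmeasD; first exact: blevel.
    by apply: bvmeasZ; apply: bvmeasB; apply: blevel => //; exact: leq_pred.
  exact: blevel.
have b2 : bvmeas (fun w => Xg w - (p * gamma) *:
    mlmc_grad M B gradF (fun i => Zs i w) m (Xg w) j).
  by apply: bvmeasB => //; exact: bvmeasZ.
split=> //; apply: bvmeasD; last exact: bvmeasZ.
by apply: bvmeasD; [apply: bvmeasD|]; exact: bvmeasZ.
Qed.

Section one_state.
Variables (m : nat) (X0 Xf : Omega -> 'rV[R]_d).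
Hypothesis bX0 : @bvmeas R d _ (past Z m) X0.
Hypothesis bXf : @bvmeas R d _ (past Z m) Xf.

Let Xg w := theta *: Xf w + (1 - theta) *: X0 w.

Let step j w := ragd_step gamma theta eta beta p M B gradF
  (fun i => Z i w) j (X0 w, Xf w, m).

Let bXg : @bvmeas R d _ (past Z m) Xg.
Proof. by apply: bvmeasD; exact: bvmeasZ. Qed.

Let D j := mlmc_err Z gradF gradf M B m Xg j.

Let gE j w : mlmc_grad M B gradF (fun i => Z i w) m (Xg w) j = gradf (Xg w) + D j w.
Proof. exact: mlmc_gradE. Qed.

Let bX0' := bvmeas_past mZ bX0.
Let bXf' := bvmeas_past mZ bXf.
Let bXg' := bvmeas_past mZ bXg.

Let bD j : bvmeas (D j).
Proof. exact: (bvmeas_mlmc_err M B mZ noise_meas noise_le S_meas bXg j). Qed.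

Lemma bvmeas_step j :
  bvmeas (fun w => (step j w).1.1) /\ bvmeas (fun w => (step j w).1.2).
Proof. by apply: bvmeas_ragd_step => // i _; exact: mZ. Qed.

Lemma expected_step n :
  \sum_(j < n) geom_half j * \int[P]_w potential (step j w) <=
  (1 - beta / 2) * \int[P]_w potential (X0 w, Xf w, m)
  + 15 * (eta ^+ 2 * p * gamma ^+ 2 * (p * K * sigma ^+ 2)).
Proof.
set q := eta ^+ 2 * p * gamma ^+ 2.
have q0 : 0 < q by rewrite /q !mulr_gt0 ?exprn_gt0.
pose c := q * (p * (1 + 2 * L * gamma)).
have c0 : 0 <= c.
  have Lg : 0 < L * gamma by rewrite mulr_gt0.
  apply: mulr_ge0; first exact: ltW.
  apply: mulr_ge0; first exact: ltW.
  by rewrite addr_ge0// -mulrA mulr_ge0// ltW.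
(* This makes the coefficient [2 * q - 2 * c] of the gradient in [U] nonnegative. *)
have cq : c <= q.
  have h1 : 0 <= K * delta ^+ 2 by apply: mulr_ge0 => //; exact: sqr_ge0.
  rewrite /c ler_piMr ?(ltW q0)//.
  by apply: (step_size_le1 p0 gamma0 L0 h1); move: hp; rewrite -(mulrA 4 K).
pose y w := (1 - beta) *: X0 w + beta *: Xg w.
pose r w := enorm (y w - xs).
pose n_ w := enorm (gradf (Xg w)).
pose base w := (1 - beta) * enorm (X0 w - xs) ^+ 2
  + (1 - p / eta) * (6 / mu * (f (Xf w) - f xs))
  - beta / 2 * enorm (Xg w - xs) ^+ 2
  - beta * (1 - beta) * enorm (X0 w - Xg w) ^+ 2.
pose A w := base w + (c - 2 * q) * n_ w ^+ 2.
(* The vector paired with the gradient error. Signs sit on the vectors and the coefficients are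
   nonnegative, so the one-sided bound [level_err_mean] applies to each summand. *)
pose U w := (2 * eta * p * gamma) *: (- (y w - xs))
  + (2 * q - 2 * c) *: (- gradf (Xg w)).
have by_ : @bvmeas R d _ (past Z m) (fun w => - (y w - xs)).
  apply: bvmeasN; apply: bvmeasB; last exact: bvmeas_cst.
  by apply: bvmeasD; exact: bvmeasZ.
have bg : @bvmeas R d _ (past Z m) (fun w => - gradf (Xg w)).
  by apply: bvmeasN; exact: bvmeas_gradf.
have bU : @bvmeas R d _ (past Z m) U by apply: bvmeasD; exact: bvmeasZ.
have by' := bvmeas_past mZ by_; have bg' := bvmeas_past mZ bg.
have br : bmeas r.
  apply: bmeas_enorm; apply: bvmeasB; last exact: bvmeas_cst.
  by apply: bvmeasD; exact: bvmeasZ.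
have bn : bmeas n_ by apply: bmeas_enorm; exact: bvmeas_gradf.
have bsub X Y : bvmeas X -> bvmeas Y ->
    bmeas (fun w : Omega => enorm (X w - Y w : 'rV[R]_d) ^+ 2).
  by move=> bX bY; apply: bmeas_enorm_sqr; exact: bvmeasB.
have bbase : bmeas base.
  apply: bmeasB; [apply: bmeasB; [apply: bmeasD|]|].
  - by apply: bmeasZ; apply: bsub => //; exact: bvmeas_cst.
  - by apply: bmeasZ; apply: bmeasZ; apply: bmeasB; [exact: bmeas_f|exact: bmeas_cst].
  - by apply: bmeasZ; apply: bsub => //; exact: bvmeas_cst.
  - by apply: bmeasZ; exact: bsub.
have bA : bmeas A by apply: bmeasD => //; apply: bmeasZ; exact: bmeasM.
have bS : bmeas (fun w => S (Xg w)) by exact: S_meas.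
have pointwise j w : potential (step j w) <=
    A w + dotv (U w) (D j w) + c * enorm (D j w) ^+ 2.
  have xgE : (eta - beta * p) *: Xg w =
      (eta - p) *: Xf w + (p * (1 - beta)) *: X0 w.
    have t2 : (1 - theta) * (eta - beta * p) = p * (1 - beta).
      by rewrite mulrBl mul1r thetaE; ring.
    rewrite /Xg scalerDr !scalerA -[(eta - p)]thetaE -t2.
    by rewrite ![_ * (eta - beta * p)]mulrC.
  have := one_step xs Lip scvx mu0 gamma0 p0 eta0 p_eta eta2 betaE
    (mlmc_grad M B gradF (fun i => Z i w) m (Xg w) j) xgE.
  rewrite -/(y w) /potential /step /ragd_step /= -/(Xg w) => h; apply: (le_trans h).
  rewrite gE [gradf _ + D j w - _]addrC addKr (enorm_sqrD (gradf (Xg w)) (D j w)).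
  rewrite /A /base /U /n_ /c /q; move: (y w - xs) => z.
  rewrite (dotvDl _ _ (D j w)) dotvDr !dotvZl !dotvNl -(enorm_sqr (gradf _)).
  rewrite le_eqVlt; apply/orP; left; apply/eqP; ring.
have mm : \sum_(j < n) geom_half j * \int[P]_w potential (step j w) <=
    \int[P]_w A w + \int[P]_w dotv (U w) (level_err Z gradF gradf B m Xg l w)
    + c * (14 * (l%:R * (19 / 3 * tau%:R / B%:R * \int[P]_w S (Xg w)))).
  apply: (@mlmc_mean _ _ _ _ _ P Q pi Z J tau d gradF gradf S M B l mZ law piQ tau0 mix
    noise_meas noise_le noise0 S_meas l0 Ml Ml1 B0 m Xg bXg n (\int[P]_w A w) c U
    (fun j => \int[P]_w potential (step j w)) (bvmeas_past mZ bU) c0).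
  - by move=> j; apply: exp_ge0 => w; exact: potential_ge0.
  - move=> j _.
    have bdot : bmeas (fun w => dotv (U w) (D j w)).
      by apply: bmeas_dotv => //; exact: (bvmeas_past mZ bU).
    have bDs : bmeas (fun w => enorm (D j w) ^+ 2) by exact: bmeas_enorm_sqr.
    rewrite -expZ// -!expD//; [|exact: bmeasD|exact: bmeasZ].
    apply: exp_le => //.
    + by have [b1 b2] := bvmeas_step j; exact: bmeas_potential.
    + by apply: bmeasD; [exact: bmeasD|exact: bmeasZ].
apply: (le_trans mm).
pose kap1 := 8 / 3 * tau%:R / (2 ^+ l * B%:R) : R.
have berr := bvmeas_level_err B mZ noise_meas noise_le S_meas bXg l.
have E1 := level_err_mean mZ law piQ tau0 mix noise_meas noise_le noise0 S_meas B0 bXg l by_.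
have E2 := level_err_mean mZ law piQ tau0 mix noise_meas noise_le noise0 S_meas B0 bXg l bg.
have UE : \int[P]_w dotv (U w) (level_err Z gradF gradf B m Xg l w) <=
   2 * eta * p * gamma * (kap1 * \int[P]_w (r w * Num.sqrt (S (Xg w))))
   + (2 * q - 2 * c) * (kap1 * \int[P]_w (n_ w * Num.sqrt (S (Xg w)))).
  under eq_Rintegral do rewrite /U dotvDl !dotvZl.
  rewrite expD; [|by apply: bmeasZ; exact: bmeas_dotv|by apply: bmeasZ; exact: bmeas_dotv].
  rewrite !expZ; [|exact: bmeas_dotv|exact: bmeas_dotv].
  apply: lerD.
  + rewrite ler_wpM2l ?mulr_ge0 ?(ltW eta0) ?(ltW p0) ?(ltW gamma0)//.
    have -> : \int[P]_w (r w * Num.sqrt (S (Xg w))) =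
        \int[P]_w (enorm (- (y w - xs)) * Num.sqrt (S (Xg w))).
      by apply: eq_Rintegral => w _; rewrite enormN.
    exact: E1.
  + rewrite ler_wpM2l ?subr_ge0 ?ler_wpM2l//.
    have -> : \int[P]_w (n_ w * Num.sqrt (S (Xg w))) =
        \int[P]_w (enorm (- gradf (Xg w)) * Num.sqrt (S (Xg w))).
      by apply: eq_Rintegral => w _; rewrite enormN.
    exact: E2.
pose kap := 14 * (l%:R * (19 / 3 * tau%:R / B%:R)) : R.
have bsq : bmeas (fun w => Num.sqrt (S (Xg w))) by exact: bmeas_sqrt.
have brs : bmeas (fun w => r w * Num.sqrt (S (Xg w))) by exact: bmeasM.
have bns : bmeas (fun w => n_ w * Num.sqrt (S (Xg w))) by exact: bmeasM.
have bpot : bmeas (fun w => potential (X0 w, Xf w, m)) by exact: bmeas_potential.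
pose W := 15 * (q * (p * K * sigma ^+ 2)).
have -> : (1 - beta / 2) * \int[P]_w potential (X0 w, Xf w, m) + W =
    \int[P]_w ((1 - beta / 2) * potential (X0 w, Xf w, m) + W).
  rewrite (expD P (bmeasZ (1 - beta / 2) bpot) (bmeas_cst Omega W)).
  by rewrite (expZ P (1 - beta / 2) bpot) exp_cst.
apply: (@le_trans _ _ (\int[P]_w (A w
   + 2 * eta * p * gamma * (kap1 * (r w * Num.sqrt (S (Xg w))))
   + (2 * q - 2 * c) * (kap1 * (n_ w * Num.sqrt (S (Xg w))))
   + c * (kap * S (Xg w))))).
  have b1 : bmeas (fun w => 2 * eta * p * gamma * (kap1 * (r w * Num.sqrt (S (Xg w))))).
    by apply: bmeasZ; exact: bmeasZ.
  have b2 : bmeas (fun w => (2 * q - 2 * c) * (kap1 * (n_ w * Num.sqrt (S (Xg w))))).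
    by apply: bmeasZ; exact: bmeasZ.
  have b3 : bmeas (fun w => c * (kap * S (Xg w))) by apply: bmeasZ; exact: bmeasZ.
  rewrite (expD P (bmeasD (bmeasD bA b1) b2) b3) (expD P (bmeasD bA b1) b2).
  rewrite (expD P bA b1) (expZ P _ (bmeasZ kap1 brs)) (expZ P kap1 brs).
  rewrite (expZ P _ (bmeasZ kap1 bns)) (expZ P kap1 bns).
  rewrite (expZ P c (bmeasZ kap bS)) (expZ P kap bS).
  rewrite -[X in _ <= X + c * (kap * _)]addrA; apply: lerD.
    by rewrite lerD2l.
  by rewrite /kap; apply: ler_wpM2l => //; rewrite !mulrA.
apply: exp_le.
- apply: bmeasD; last by apply: bmeasZ; exact: bmeasZ.
  apply: bmeasD; last by apply: bmeasZ; exact: bmeasZ.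
  by apply: bmeasD => //; apply: bmeasZ; exact: bmeasZ.
- by apply: bmeasD; [exact: bmeasZ|exact: bmeas_cst].
move=> w.
have kap0 : 0 <= kap by rewrite /kap !mulr_ge0 ?invr_ge0.
have := @noise_budget R p gamma L eta beta K delta sigma kap kap1 (r w) (n_ w)
  (S (Xg w)) q c gamma0 L0 u34 p0 eta0 beta0 K0 kap0 hkap hp hkap1 erefl erefl erefl.
set s := Num.sqrt _ => nb.
(* [noise_budget] carries the coefficient [2 * q] where [2 * q - 2 * c] occurs; the difference has
   the right sign. *)
have ns0 : 0 <= c * (n_ w * (kap1 * s)).
  apply: mulr_ge0 => //; apply: mulr_ge0; first exact: enorm_ge0.
  apply: mulr_ge0; last exact: sqrtr_ge0.
  by rewrite /kap1 divr_ge0 ?mulr_ge0 ?exprn_ge0.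
have ynorm : r w ^+ 2 = (1 - beta) * enorm (X0 w - xs) ^+ 2 +
   beta * enorm (Xg w - xs) ^+ 2 - beta * (1 - beta) * enorm (X0 w - Xg w) ^+ 2.
  have -> : r w = enorm ((Xg w - xs) + (1 - beta) *: (X0 w - Xg w)).
    by congr enorm; apply/rowP => i; rewrite /y !mxE; ring.
  have -> : X0 w - xs = (Xg w - xs) + (X0 w - Xg w) by apply/rowP => i; rewrite !mxE; ring.
  move: (Xg w - xs) (X0 w - Xg w) => a b.
  by rewrite !enorm_sqr !dotvE (dotvC b a); ring.
rewrite /A /base /potential /=.
rewrite -beta_eta.
have := step_combine (6 / mu * (f (Xf w) - f xs)) beta0 beta1
  (sqr_ge0 (enorm (X0 w - xs))) (sqr_ge0 (enorm (Xg w - xs)))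
  (sqr_ge0 (enorm (X0 w - Xg w))) nb ns0 ynorm.
exact.
Qed.

End one_state.

(** * From prescribed level sequences to the full run *)

Variable x0 : 'rV[R]_d.

Lemma ragd_ext (Zs : nat -> Zsp) (js js' : nat -> nat) k :
  (forall i, (i < k)%N -> js i = js' i) ->
  ragd gamma theta eta beta p M B gradF Zs js x0 k =
  ragd gamma theta eta beta p M B gradF Zs js' x0 k.
Proof.
elim: k => [//|k IH] jj /=; rewrite jj// IH// => i ik.
by apply: jj; rewrite ltnS ltnW.
Qed.

(* The sample window of a step depends on the earlier [J_k], so the iterates are
   first studied along a prescribed sequence [js], where these windows are fixed. *)
Definition traj_along (js : seq nat) (w : Omega) :=
  ragd gamma theta eta beta p M B gradF (fun i => Z i w) (nth 0%N js) x0 (size js).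

Definition time (js : seq nat) : nat := \sum_(j <- js) (2 ^ j * B)%N.

Lemma traj_rcons js j w : traj_along (rcons js j) w =
  ragd_step gamma theta eta beta p M B gradF (fun i => Z i w) j (traj_along js w).
Proof.
rewrite /traj_along size_rcons /= nth_rcons ltnn eqxx; congr ragd_step.
by apply: ragd_ext => i ik; rewrite nth_rcons ik.
Qed.

Lemma traj_time js w : (traj_along js w).2 = time js.
Proof.
elim/last_ind: js => [|js j IH]; first by rewrite /time big_nil.
rewrite traj_rcons /time -cats1 big_cat big_seq1 -/(time js) -IH.
by rewrite /ragd_step; case: (traj_along js w) => -[].
Qed.

Lemma trajE js w : traj_along js w = ((traj_along js w).1.1, (traj_along js w).1.2, time js).
Proof. by rewrite -(traj_time js w); case: (traj_along js w) => -[]. Qed.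

(** A step started at time [T] reads states only up to [T + 2 ^ j * B], the starting time of the
    next step. *)
Lemma bvmeas_traj js :
  @bvmeas R d _ (past Z (time js)) (fun w => (traj_along js w).1.1) /\
  @bvmeas R d _ (past Z (time js)) (fun w => (traj_along js w).1.2).
Proof.
elim/last_ind: js => [|js j [IH1 IH2]]; first by split; exact: bvmeas_cst.
have tE : time (rcons js j) = (time js + 2 ^ j * B)%N.
  by rewrite /time -cats1 big_cat big_seq1.
have le_t : (time js <= time (rcons js j))%N by rewrite tE leq_addr.
have := @bvmeas_ragd_step _ (past Z (time (rcons js j))) Z (time js) j _ _ _
  (bvmeas_mono le_t IH1) (bvmeas_mono le_t IH2).
have -> : (fun w => (traj_along (rcons js j) w).1.1) = (fun w =>
    (ragd_step gamma theta eta beta p M B gradF (fun i => Z i w) j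
       ((traj_along js w).1.1, (traj_along js w).1.2, time js)).1.1).
  by apply/funext => w; rewrite traj_rcons -trajE.
have -> : (fun w => (traj_along (rcons js j) w).1.2) = (fun w =>
    (ragd_step gamma theta eta beta p M B gradF (fun i => Z i w) j
       ((traj_along js w).1.1, (traj_along js w).1.2, time js)).1.2).
  by apply/funext => w; rewrite traj_rcons -trajE.
apply=> i it; apply: measurable_past_Z.
by rewrite tE.
Qed.

Let full (k : nat) (w : Omega) :=
  ragd gamma theta eta beta p M B gradF (fun i => Z i w) (fun k => J k w) x0 k.
Hypothesis full_meas : forall k, vmeas (fun w => (full k w).1.1) /\
  vmeas (fun w => (full k w).1.2).

Lemma full_traj js w : cylJ J js w -> full (size js) w = traj_along js w.
Proof. by move=> h; apply: ragd_ext => i ij; exact: h. Qed.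

Let V js := \int[P]_w potential (traj_along js w).
Let T := 15 * (eta ^+ 2 * p * gamma ^+ 2 * (p * K * sigma ^+ 2)).
Let rho := 1 - beta / 2.

Lemma expected_traj_step (js : seq nat) n :
  \sum_(j < n) geom_half j * V (rcons js j) <= rho * V js + T.
Proof.
have [b1 b2] := bvmeas_traj js.
have := expected_step b1 b2 n.
have -> : \int[P]_w potential ((traj_along js w).1.1, (traj_along js w).1.2, time js) = V js.
  by apply: eq_Rintegral => w _; rewrite -trajE.
move=> h; apply: le_trans h; rewrite le_eqVlt; apply/orP; left; apply/eqP.
apply: eq_bigr => j _; congr (_ * _); apply: eq_Rintegral => w _.
by rewrite traj_rcons -trajE.
Qed.

(** Induction on the steps still to come, for every prefix [js]. Independence enters when none is
    left, where the trajectory depends only on the past at [time js]. Otherwise the event is split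
    by the next level, and [expected_traj_step] averages the bounds obtained on the pieces. *)
Lemma full_bound n js :
  (\int[P]_(w in cylJ J js) (potential (full (size js + n) w))%:E <=
   ((\prod_(j <- js) geom_half j) * (rho ^+ n * V js + T * \sum_(i < n) rho ^+ i))%:E)%E.
Proof.
have g0 js' : 0 <= \prod_(j <- js') geom_half j :> R.
  by apply: prodr_ge0 => j _; rewrite /geom_half; case: ifP => // _; rewrite invr_ge0 exprn_ge0.
have rho0 : 0 <= rho by rewrite subr_ge0; move: beta1; lra.
have T0 : 0 <= T.
  apply: mulr_ge0 => //; apply: mulr_ge0; (apply: mulr_ge0; last exact: sqr_ge0).
    by apply: mulr_ge0; [exact: sqr_ge0|exact: ltW].
  by apply: mulr_ge0 => //; exact: ltW.
elim: n js => [|n IH] js.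
  rewrite expr0 mul1r big_ord0 mulr0 addr0 addn0.
  have [b1 b2] := bvmeas_traj js.
  have bp : @bmeas _ (past Z (time js)) R (fun w => potential (traj_along js w)).
    exact: bmeas_potential.
  rewrite (eq_integral (fun w => (potential (traj_along js w))%:E)); last first.
    by move=> w; rewrite inE => wj; rewrite full_traj.
  rewrite (@independence_past _ _ _ _ _ P Q pi Z J mZ mJ law (time js) js
    (fun w => (potential (traj_along js w))%:E)); last 2 first.
  - by apply/measurable_EFinP; case: bp.
  - by move=> w; rewrite lee_fin potential_ge0.
  by rewrite EFin_Rintegral//; exact: bmeas_potential (bvmeas_past mZ b1) (bvmeas_past mZ b2).
have -> : cylJ J js = \bigcup_j cylJ J (rcons js j).
  apply/seteqP; split=> [w h|w [j _ h] k kj].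
    exists (J (size js) w) => // k; rewrite size_rcons ltnS leq_eqVlt => /predU1P[->|kj].
      by rewrite nth_rcons ltnn eqxx.
    by rewrite nth_rcons kj; exact: h.
  by have := h k; rewrite size_rcons ltnS => /(_ (ltnW kj)); rewrite nth_rcons kj.
rewrite ge0_integral_bigcup//=; last 4 first.
- by move=> j; exact: measurable_cylJ.
- apply: (@measurable_funS _ _ _ _ setT) => //.
  apply/measurable_EFinP; have [m1 m2] := full_meas (size js + n.+1)%N.
  apply: measurable_funD.
    apply: measurable_funX; apply: measurableT_comp.
      by apply: continuous_measurable_fun; exact: sqrt_continuous.
    apply: measurable_sum => i; under eq_fun do rewrite !mxE.
    by apply: measurable_funM; apply: measurable_funB => //; exact: m1.
  apply: measurable_funM => //; apply: measurable_funB => //; exact: f_meas.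
- by move=> w _; rewrite lee_fin potential_ge0.
- apply/trivIsetP => i j _ _ ij; apply/seteqP; split=> // w [/= hi hj].
  move/eqP: ij; apply.
  have := hi (size js); have := hj (size js); rewrite !size_rcons !nth_rcons !ltnn !eqxx ltnS leqnn.
  by move=> <-// <-.
have step j : (\int[P]_(w in cylJ J (rcons js j)) (potential (full (size js + n.+1) w))%:E <=
   ((\prod_(j <- js) geom_half j * geom_half j) *
     (rho ^+ n * V (rcons js j) + T * \sum_(i < n) rho ^+ i))%:E)%E.
  have := IH (rcons js j); rewrite size_rcons addSnnS -cats1 big_cat big_seq1.
  by rewrite cats1.
(* The series over the next level is bounded through its partial sums, which is why
   [expected_traj_step] has a free [n]. *)
apply: lime_le.
  by apply: is_cvg_nneseries => j _ _; apply: integral_ge0 => w _; rewrite lee_fin potential_ge0.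
apply: nearW => m.
apply: (le_trans (lee_sum _ (fun j _ => step j))).
rewrite sumEFin lee_fin big_mkord.
set g := \prod_(j <- js) _; set G := \sum_(i < n) rho ^+ i.
have -> : \sum_(j < m) g * geom_half j * (rho ^+ n * V (rcons js j) + T * G) =
   g * (rho ^+ n * \sum_(j < m) geom_half j * V (rcons js j) + T * G * \sum_(j < m) geom_half j).
  by rewrite !mulr_sumr -big_split/= mulr_sumr; apply: eq_bigr => j _; ring.
have s1 : \sum_(j < m) geom_half j <= 1 :> R.
  have := @geom_sum_le R 0 m (fun=> 1) (fun=> 1) 1.
  rewrite big_ord1 /geom_half/= mul0r add0r expr0 mul1r.
  under eq_bigr do rewrite mulr1.
  exact.
have G0 : 0 <= G by apply: sumr_ge0 => i _; rewrite exprn_ge0.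
apply: ler_wpM2l; first exact: g0.
rewrite big_ord_recr/= -/G mulrDr addrCA addrC exprSr -mulrA [T * rho ^+ n]mulrC.
rewrite -[_ * rho * _]mulrA.
have h1 := ler_wpM2l (exprn_ge0 n rho0) (expected_traj_step js m).
have h2 := ler_wpM2l (mulr_ge0 T0 G0) s1.
move: h1 h2; rewrite mulrDr mulr1; lra.
Qed.

End expected_step.

(** * The prescribed parameters *)

Section parameters.
Variable R : realType.

(** Adding the strong convexity inequalities between [0] and a unit vector [u] gives
    [mu <= dotv (gradf u - gradf 0) u <= L]; a unit vector exists because [0 < d]. *)
Lemma strong_convexity_le_smoothness (d : nat) (f : 'rV[R]_d -> R)
    (gradf : 'rV[R]_d -> 'rV[R]_d) (L mu : R) : (0 < d)%N ->
  (forall x y, enorm (gradf x - gradf y) <= L * enorm (x - y)) ->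
  (forall x y, f x - f y - dotv (gradf y) (x - y) >= mu / 2 * enorm (x - y) ^+ 2) ->
  mu <= L.
Proof.
move=> d0 Lip scvx; pose u : 'rV[R]_d := delta_mx ord0 (Ordinal d0).
have u1 : enorm u = 1.
  rewrite /enorm /dotv (bigD1 (Ordinal d0))//= !mxE !eqxx mulr1 big1 ?addr0 ?sqrtr1//.
  by move=> i /negPf ni; rewrite mxE ni andbF mulr0.
have h1 := scvx u 0; have h2 := scvx 0 u.
have h3 := dotv_le (gradf u - gradf 0) u; have h4 := Lip u 0.
move: h1 h2 h3 h4.
rewrite subr0 sub0r enormN u1 dotvNr dotvBl !mulr1 expr1n; lra.
Qed.

Lemma ex_level (M : R) : 2 <= M ->
  exists l, [/\ (0 < l)%N, (2 ^ l)%N%:R <= M & M < (2 ^ l.+1)%N%:R].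
Proof.
move=> M2; have M0 : 0 <= M by rewrite (le_trans _ M2).
have /andP[m1 m2] := truncn_itv M0.
have m0 : (2 <= Num.truncn M)%N by rewrite truncn_ge_nat.
exists (trunc_log 2 (Num.truncn M)); split.
- by rewrite trunc_log_gt0.
- by apply: le_trans m1; rewrite ler_nat trunc_logP// (leq_trans _ m0).
- by apply: (lt_le_trans m2); rewrite ler_nat trunc_log_ltn.
Qed.

Lemma le_batch (M : R) (b l : nat) : (2 ^ l)%N%:R <= M ->
  b%:R * l%:R <= `|Num.ceil (b%:R * (ln M / ln 2))|%N%:R :> R.
Proof.
move=> lM; have ln20 : 0 < ln 2 :> R by rewrite ln_gt0// ltr1n.
have lnM : l%:R * ln 2 <= ln M.
  have e0 : 0 < (2 ^ l)%N%:R :> R by rewrite ltr0n expn_gt0.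
  have : ln (2 ^ l)%N%:R <= ln M by rewrite ler_ln ?posrE// (lt_le_trans e0).
  by rewrite natrX lnXn// mulr_natl.
set x := b%:R * (_ / _).
have bx : b%:R * l%:R <= x by rewrite ler_wpM2l// ler_pdivlMr.
have cx : x <= (Num.ceil x)%:~R by exact: ceil_ge.
have c0 : 0 <= Num.ceil x.
  by rewrite -(ler_int R) (le_trans _ cx)// (le_trans _ bx)// mulr_ge0.
by rewrite natr_absz ger0_norm// (le_trans bx).
Qed.

(** [B >= b * l] cancels the number of levels; what remains is [14 * 19 / 3 <= 16 * (111 / 20)],
    which barely holds. *)
Lemma variance_budget (t b l B K : R) : 0 <= t -> 0 < b -> 0 < l -> b * l <= B ->
  16 * t / b <= K -> 14 * (l * (19 / 3 * t / B)) <= 111 / 20 * K.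
Proof.
move=> t0 b0 l0 bl tK; have bl0 : 0 < b * l by rewrite mulr_gt0.
have B0 : 0 < B by exact: lt_le_trans bl.
have h : l * (t / B) <= t / b.
  rewrite mulrA ler_pdivrMr// mulrAC ler_pdivlMr// [l * t]mulrC -!mulrA.
  by apply: ler_wpM2l => //; rewrite mulrC.
have h0 : 0 <= t / b by rewrite divr_ge0// ltW.
have -> : 14 * (l * (19 / 3 * t / B)) = 14 * 19 / 3 * (l * (t / B)) by ring.
by move: h h0 tK; rewrite -mulrA; lra.
Qed.

(** Here [s] is [2 ^+ l], at least [M / 2], and [c] is [1 + 2 * p / beta]. The choice of [M] gives
    [c <= 3 / 64 * p * s ^+ 2]; then [(8 / 3) ^+ 2 * (3 / 64) = 1 / 3], and the 17 in the bound on
    [K] makes this [1 / 51]. *)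
Lemma bias_budget (t b s B K M p c : R) : 0 < b -> 0 < s -> b <= B ->
  0 < p -> 0 <= M -> M <= 2 * s -> 256 / 3 / p * c <= M ^+ 2 ->
  17 * t ^+ 2 / b ^+ 2 <= K ->
  (8 / 3 * t / (s * B)) ^+ 2 * c <= p * K / 51.
Proof.
move=> b0 s0 bB p0 M0 Ms cM tK; have B0 : 0 < B by exact: lt_le_trans bB.
have c_le : c <= 3 / 64 * p * s ^+ 2.
  have : M ^+ 2 <= (2 * s) ^+ 2 by rewrite ler_sqr ?nnegrE// mulr_ge0// ltW.
  move=> /(le_trans cM); rewrite -mulrA [p^-1 * c]mulrC mulrA ler_pdivrMr// exprMn.
  lra.
have ts0 : 0 <= (8 / 3 * t / (s * B)) ^+ 2 by exact: sqr_ge0.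
apply: (le_trans (ler_wpM2l ts0 c_le)).
have -> : (8 / 3 * t / (s * B)) ^+ 2 * (3 / 64 * p * s ^+ 2) = p / 3 * (t ^+ 2 / B ^+ 2).
  by field; rewrite !gt_eqF.
have tb : t ^+ 2 / B ^+ 2 <= t ^+ 2 / b ^+ 2.
  rewrite ler_wpM2l ?sqr_ge0// lef_pV2 ?posrE ?exprn_gt0//.
  by rewrite ler_sqr ?nnegrE// ltW.
have h : t ^+ 2 / b ^+ 2 <= K / 17 by move: tK; rewrite -mulrA; lra.
have := ler_wpM2l (ltW p0) (le_trans tb h); lra.
Qed.

Section step_sizes.
Variables p mu gamma : R.
Hypotheses (p0 : 0 < p) (p1 : p <= 1) (mu0 : 0 < mu) (gamma0 : 0 < gamma)
  (mug : mu * gamma <= 3 / 4).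
Let eta := Num.sqrt (3 / (mu * gamma)).
Let beta := Num.sqrt (4 * p ^+ 2 * mu * gamma / 3).

Let mg0 : 0 < mu * gamma. Proof. by rewrite mulr_gt0. Qed.

Lemma eta_sqr : eta ^+ 2 * (mu * gamma) = 3.
Proof. by rewrite sqr_sqrtr ?divr_ge0 ?(ltW mg0)// divfK// gt_eqF. Qed.

Lemma eta_ge2 : 2 <= eta.
Proof.
have -> : 2 = Num.sqrt (2 ^+ 2) :> R by rewrite sqrtr_sqr ger0_norm.
rewrite ler_sqrt ?divr_ge0 ?(ltW mg0)// ler_pdivlMr// ; move: mug; lra.
Qed.

Let eta0 : 0 < eta. Proof. exact: lt_le_trans eta_ge2. Qed.

Lemma rateE : Num.sqrt (p ^+ 2 * mu * gamma / 3) = p / eta.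
Proof.
have -> : p ^+ 2 * mu * gamma / 3 = (p / eta) ^+ 2.
  rewrite expr_div_n sqr_sqrtr ?divr_ge0 ?(ltW mg0)//.
  by field; rewrite !gt_eqF.
by rewrite sqrtr_sqr ger0_norm// divr_ge0// ltW.
Qed.

Lemma betaE_eta : beta = 2 * (p / eta).
Proof.
rewrite -rateE -[in RHS](@ger0_norm _ 2)// -sqrtr_sqr -sqrtrM ?sqr_ge0//.
by congr Num.sqrt; ring.
Qed.

Lemma beta_half : beta / 2 = p / eta.
Proof. by rewrite betaE_eta mulrAC divff// mul1r. Qed.

Lemma beta_gt0 : 0 < beta.
Proof. by rewrite betaE_eta mulr_gt0// divr_gt0. Qed.

Lemma beta_le1 : beta <= 1.
Proof.
rewrite betaE_eta mulrA ler_pdivrMr// mul1r; have := eta_ge2; move: p1; lra.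
Qed.

Lemma beta3E : beta * 3 = 2 * eta * gamma * p * mu.
Proof. by rewrite betaE_eta -eta_sqr; field; rewrite gt_eqF. Qed.

Lemma thetaE_eta :
  (p / eta - 1) / (beta * p / eta - 1) * (eta - beta * p) = eta - p.
Proof.
(* The denominator of [theta] cannot vanish, because [beta * p <= 1 < 2 <= eta]. *)
have h : beta * p - eta != 0.
  rewrite subr_eq0 lt_eqF//; apply: (@lt_le_trans _ _ 2); last exact: eta_ge2.
  apply: (@le_lt_trans _ _ 1); last by rewrite ltr1n.
  by rewrite mulr_ile1 ?beta_le1 ?(ltW beta_gt0)// ltW.
have := lt0r_neq0 eta0; move: h; generalize eta beta => e b h e0.
by field; rewrite mulN1r e0.
Qed.

(** [90 = 15 * 3 * 2], where 3 is [eta ^+ 2 * (mu * gamma)] and 2 bounds the factor $\sqrt3$ in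
    $\eta\gamma=\sqrt3\,\sqrt\gamma/\sqrt\mu$. *)
Lemma stationary_error (K s : R) : 0 <= K -> 0 <= s ->
  15 * (eta ^+ 2 * p * gamma ^+ 2 * (p * K * s)) * (eta / p) <=
  90 * (p * Num.sqrt gamma / (mu * Num.sqrt mu) * (K * s)).
Proof.
move=> K0 s0.
have -> : 15 * (eta ^+ 2 * p * gamma ^+ 2 * (p * K * s)) * (eta / p) =
    15 * (eta ^+ 2 * (mu * gamma)) * (eta * gamma) * (p * (K * s)) / mu.
  by field; rewrite !gt_eqF.
rewrite eta_sqr.
have sg0 : 0 < Num.sqrt gamma by rewrite sqrtr_gt0.
have sm0 : 0 < Num.sqrt mu by rewrite sqrtr_gt0.
have h : eta * gamma <= 2 * (Num.sqrt gamma / Num.sqrt mu).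
  rewrite mulrA ler_pdivlMr// -{1}(sqr_sqrtr (ltW gamma0)).
  have -> : eta * Num.sqrt gamma ^+ 2 * Num.sqrt mu =
      (eta * Num.sqrt (mu * gamma)) * Num.sqrt gamma.
    by rewrite sqrtrM ?(ltW mu0)//; ring.
  rewrite ler_pM2r// -sqrtrM ?divr_ge0 ?(ltW mg0)// divfK ?gt_eqF//.
  have -> : 2 = Num.sqrt (2 ^+ 2) :> R by rewrite sqrtr_sqr ger0_norm.
  by rewrite ler_sqrt//; lra.
have h0 : 0 <= p * (K * s) / mu.
  by rewrite divr_ge0 ?(ltW mu0)// !mulr_ge0// ltW.
have := ler_wpM2r h0 h.
have -> : p * Num.sqrt gamma / (mu * Num.sqrt mu) * (K * s) =
    (Num.sqrt gamma / Num.sqrt mu) * (p * (K * s) / mu).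
  by field; rewrite !gt_eqF.
rewrite -[X in X <= _]mulrA [_ * (p * _) / mu](_ : _ = 15 * 3 * (eta * gamma * (p * (K * s) / mu)));
  last by ring.
lra.
Qed.

Lemma contraction_le_exp (n : nat) :
  (1 - beta / 2) ^+ n <= expR (- (n%:R * Num.sqrt (p ^+ 2 * mu * gamma / 3))).
Proof.
rewrite rateE -beta_half -[- (n%:R * _)]mulrN expRM_natl.
have h := beta_le1; rewrite lerXn2r ?nnegrE ?expR_ge0 ?expR_ge1Dx//; lra.
Qed.

(** The whole geometric series sums to [2 / beta], which is [eta / p]. *)
Lemma contraction_sum_le (n : nat) : \sum_(i < n) (1 - beta / 2) ^+ i <= eta / p.
Proof.
have b0 : 0 < beta / 2 by rewrite divr_gt0// beta_gt0.
rewrite -[eta / p]invf_div -beta_half.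
rewrite -[leRHS]mul1r ler_pdivlMr// mulrC.
have := subrX1 (1 - beta / 2) n.
have -> : 1 - beta / 2 - 1 = - (beta / 2) by ring.
move=> h.
have r0 : 0 <= (1 - beta / 2) ^+ n by apply: exprn_ge0; have := beta_le1; lra.
lra.
Qed.

End step_sizes.
End parameters.

Theorem theorem1 (R : realType) :
  exists C : R, 0 < C /\
  forall (d : nat) (dz : measure_display) (Zsp : measurableType dz)
    (dO : measure_display) (Omega : measurableType dO) (P : probability Omega R)
    (f : 'rV[R]_d -> R) (gradf : 'rV[R]_d -> 'rV[R]_d)
    (F : 'rV[R]_d -> Zsp -> R) (gradF : 'rV[R]_d -> Zsp -> 'rV[R]_d)
    (Q : R.-pker Zsp ~> Zsp) (pi : probability Zsp R)
    (Z : nat -> Omega -> Zsp) (J : nat -> Omega -> nat)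
    (L mu sigma delta gamma : R) (tau b N : nat) (xstar x0 : 'rV[R]_d),
  (* f is differentiable with gradient gradf, L-smooth, mu-strongly convex *)
  0 < L -> 0 < mu ->
  (forall x, is_gradient f (gradf x) x) ->
  (forall x y, enorm (gradf x - gradf y) <= L * enorm (x - y)) ->
  (forall x y, f x - f y - dotv (gradf y) (x - y) >= mu / 2 * enorm (x - y) ^+ 2) ->
  (forall x, f xstar <= f x) ->
  (* f(x) = E_pi[F(x,Z)], gradF(.,z) is the gradient of F(.,z),
     E_pi[gradF(x,Z)] = grad f(x), and the noise bound *)
  (forall x z, is_gradient (fun y => F y z) (gradF x z) x) ->
  (forall x, pi.-integrable setT (fun z => (F x z)%:E) /\
             (f x)%:E = (\int[pi]_z (F x z)%:E)%E) ->
  (forall x (i : 'I_d), pi.-integrable setT (fun z => (gradF x z ord0 i)%:E) /\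
             (gradf x ord0 i)%:E = (\int[pi]_z (gradF x z ord0 i)%:E)%E) ->
  0 <= sigma -> 0 <= delta ->
  (forall x z, enorm (gradF x z - gradf x) ^+ 2
               <= sigma ^+ 2 + delta ^+ 2 * enorm (gradf x) ^+ 2) ->
  (* Markov kernel Q with unique invariant distribution pi and mixing time tau *)
  kernel_invariant Q pi ->
  (forall nu : probability Zsp R, kernel_invariant Q nu ->
     forall A, measurable A -> nu A = pi A) ->
  (0 < tau)%N ->
  (forall (k : nat) (z z' : Zsp),
     half_tv_le (Qpow Q k z) (Qpow Q k z') ((4^-1) ^+ (k %/ tau))) ->
  (* (Z_i) is a stationary Markov chain with kernel Q and initial law pi,
     (J_k) are i.i.d. Geom(1/2), independent of (Z_i) *)
  (forall i, measurable_fun setT (Z i)) ->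
  (forall k j, measurable [set w | J k w = j]) ->
  (forall (As : seq (set Zsp)) (js : seq nat),
     (forall i, (i < size As)%N -> measurable (nth setT As i)) ->
     P [set w | (forall i, (i < size As)%N -> nth setT As i (Z i w)) /\
                (forall k, (k < size js)%N -> J k w = nth 0%N js k)]
     = ((\int[pi]_z path_prob Q As z) * (\prod_(j <- js) geom_half j)%:E)%E) ->
  (* parameters *)
  (0 < b)%N ->
  0 < gamma -> gamma <= 3 / (4 * L) ->
  let C1 := 16 * (1 + 1 / (ln 4) ^+ 2) in
  let C2 := 256 / 3 in
  let p := (1 + 2 * (1 + gamma * L) *
              (1 + 4 * (C1 * tau%:R / b%:R + (C1 + 1) * tau%:R ^+ 2 / b%:R ^+ 2)
                     * delta ^+ 2))^-1 in
  let beta := Num.sqrt (4 * p ^+ 2 * mu * gamma / 3) in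
  let eta := Num.sqrt (3 / (mu * gamma)) in
  let theta := (p / eta - 1) / (beta * p / eta - 1) in
  let M := Num.max 2 (Num.sqrt (C2 / p * (1 + 2 * p / beta))) in
  let B := `|Num.ceil (b%:R * (ln M / ln 2))|%N in
  let traj := fun (w : Omega) (k : nat) =>
    ragd gamma theta eta beta p M B gradF (fun i => Z i w) (fun k => J k w) x0 k in
  (* the iterates are random variables *)
  (forall k (i : 'I_d), measurable_fun setT (fun w => (traj w k).1.1 ord0 i) /\
                        measurable_fun setT (fun w => (traj w k).1.2 ord0 i)) ->
  (\int[P]_w (enorm ((traj w N).1.1 - xstar) ^+ 2
              + 6 / mu * (f (traj w N).1.2 - f xstar))%:E
   <= (C * (expR (- (N%:R * Num.sqrt (p ^+ 2 * mu * gamma / 3)))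
              * (enorm (x0 - xstar) ^+ 2 + 6 / mu * (f x0 - f xstar))
            + p * Num.sqrt gamma / (mu * Num.sqrt mu)
              * (sigma ^+ 2 * tau%:R / b%:R + sigma ^+ 2 * tau%:R ^+ 2 / b%:R ^+ 2)))%:E)%E.
Proof.
pose c : R := 16 * (1 + 1 / (ln 4) ^+ 2).
have c16 : 16 <= c.
  have : 0 <= 1 / (ln 4) ^+ 2 :> R by rewrite divr_ge0// sqr_ge0.
  rewrite /c; lra.
(* 90 is the constant of [stationary_error], and [c + 1] dominates both coefficients in the bracket
   [K]. *)
exists (90 * (c + 1)); split; first lra.
move=> d dz Zsp dO Omega P f gradf F gradF Q pi Z J L mu sigma delta gamma tau b N
  xs x0 L0 mu0 gf Lip scvx fmin gF intF intG s0 d0 noise_le piQ _ tau0 mix mZ mJ law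
  b0 gamma0 gL C1 C2 p beta eta theta M B traj mtraj.
have bR : 0 < b%:R :> R by rewrite ltr0n.
have tR : 0 <= tau%:R :> R by [].
pose K : R := C1 * tau%:R / b%:R + (C1 + 1) * tau%:R ^+ 2 / b%:R ^+ 2.
have cC : C1 = c by [].
clearbody c.
have KE : K = c * (tau%:R / b%:R) + (c + 1) * (tau%:R ^+ 2 / b%:R ^+ 2).
  by rewrite /K cC; ring.
have t1 : 0 <= tau%:R / b%:R :> R by rewrite divr_ge0.
have t2 : 0 <= tau%:R ^+ 2 / b%:R ^+ 2 :> R by rewrite divr_ge0 ?sqr_ge0.
have K1 : 16 * tau%:R / b%:R <= K.
  rewrite KE -mulrA.
  have h1 := ler_wpM2r t1 c16.
  have h2 : 0 <= (c + 1) * (tau%:R ^+ 2 / b%:R ^+ 2) by apply: mulr_ge0 => //; lra.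
  lra.
have K2 : 17 * tau%:R ^+ 2 / b%:R ^+ 2 <= K.
  rewrite KE -mulrA.
  have h1 := ler_wpM2r t2 c16.
  have h2 : 0 <= c * (tau%:R / b%:R) by apply: mulr_ge0 => //; lra.
  lra.
have K0 : 0 <= K by apply: le_trans K1; rewrite -mulrA mulr_ge0.
pose D : R := 2 * (1 + gamma * L) * (1 + 4 * K * delta ^+ 2).
have D0 : 0 <= D.
  have gL0 : 0 < gamma * L by rewrite mulr_gt0.
  by rewrite /D !mulr_ge0// ?addr_ge0 ?mulr_ge0 ?sqr_ge0// ltW.
have pE : p * (1 + D) = 1 by rewrite mulVf// gt_eqF// ltr_wpDr.
have p0 : 0 < p by rewrite invr_gt0 ltr_wpDr.
have p1 : p <= 1 by rewrite invf_le1 ?lerDl// ltr_wpDr.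
have hp : p * D <= 1 by move: pE p0; rewrite mulrDr mulr1; lra.
have err0 : 0 <= sigma ^+ 2 * tau%:R / b%:R + sigma ^+ 2 * tau%:R ^+ 2 / b%:R ^+ 2.
  by rewrite addr_ge0 ?divr_ge0 ?mulr_ge0 ?sqr_ge0.
have fac0 : 0 <= p * Num.sqrt gamma / (mu * Num.sqrt mu).
  by rewrite divr_ge0 ?mulr_ge0 ?sqrtr_ge0// ltW.
pose Psi0 := enorm (x0 - xs) ^+ 2 + 6 / mu * (f x0 - f xs).
have Psi00 : 0 <= Psi0.
  rewrite addr_ge0 ?sqr_ge0// mulr_ge0 ?subr_ge0// divr_ge0// ltW//.
(* In dimension 0 the inequality [mu <= L] may fail, but there all points coincide and the left-hand
   side is zero. *)
have [d_eq0|d_gt0] := posnP d.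
  have V0 (x y : 'rV[R]_d) : x = y by apply/rowP => i; have := leq_trans (ltn_ord i) (eq_leq d_eq0).
  rewrite (eq_integral (cst 0%E)); last first.
    move=> w _; rewrite (V0 (traj w N).1.2 xs) (V0 ((traj w N).1.1 - xs) 0).
    by rewrite subrr mulr0 addr0 enorm_sqr -(scale0r 0) dotvZl mul0r.
  rewrite integral0 lee_fin mulr_ge0//; first lra.
  by apply: addr_ge0; apply: mulr_ge0 => //; exact: expR_ge0.
have u34 : gamma * L <= 3 / 4.
  by move: gL; rewrite ler_pdivlMr ?mulr_gt0//; lra.
have mug : mu * gamma <= 3 / 4.
  apply: le_trans u34; rewrite mulrC ler_pM2l//.
  exact: strong_convexity_le_smoothness d_gt0 Lip scvx.
have M2 : 2 <= M by rewrite le_max lexx.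
have [l [l0 lM lM1]] := ex_level M2.
have bl : b%:R * l%:R <= B%:R :> R by exact: le_batch.
have lR : 0 < l%:R :> R by rewrite ltr0n.
have bB : b%:R <= B%:R :> R.
  by apply: le_trans bl; rewrite ler_peMr ?(ltW bR)// ler1n.
have B0 : (0 < B)%N by rewrite -(ltr0n R) (lt_le_trans bR).
have hkap := variance_budget tR bR lR bl K1.
have beta0 := beta_gt0 p0 mu0 gamma0 mug.
have hkap1 : (8 / 3 * tau%:R / (2 ^+ l * B%:R)) ^+ 2 * (1 + 2 * p / beta) <= p * K / 51.
  have c0 : 0 <= C2 / p * (1 + 2 * p / beta).
    rewrite mulr_ge0 ?divr_ge0 ?(ltW p0)//.
    by rewrite addr_ge0// divr_ge0 ?mulr_ge0 ?(ltW p0) ?(ltW beta0).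
  apply: (@bias_budget R tau%:R b%:R (2 ^+ l) B%:R K M p) => //.
  - by apply: le_trans M2.
  - by move: lM1; rewrite natrX exprS => /ltW.
  - rewrite -(sqr_sqrtr c0) ler_sqr ?nnegrE ?sqrtr_ge0//; last exact: le_trans M2.
    by rewrite le_max lexx orbT.
have mF x : measurable_fun setT (F x).
  by apply/measurable_EFinP; have [/integrableP[]] := intF x.
have mgF dT (T : measurableType dT) X (Y : T -> Zsp) : vmeas X ->
    measurable_fun setT Y -> vmeas (fun w => gradF (X w) (Y w)).
  by move=> mX mY; exact: measurable_gradient mX mY mF gF.
have mgf dT (T : measurableType dT) (X : T -> 'rV[R]_d) : vmeas X ->
    vmeas (fun w => gradf (X w)).
  (* The deterministic [f] is treated as a family constant in its second argument, with [T] itself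
     as parameter space. *)
  move=> mX; exact: (@measurable_gradient R d _ T _ T X id (fun x _ => f x)
    (fun x _ => gradf x) mX (@measurable_id _ _ _) (fun x => measurable_cst _)
    (fun x _ => gf x)).
have mf dT (T : measurableType dT) (X : T -> 'rV[R]_d) : vmeas X ->
    measurable_fun setT (fun w => f (X w)).
  move=> mX; apply: (@measurable_caratheodory R d _ T _ T X id (fun x _ => f x)) => //.
  by move=> _ x; apply: differentiable_continuous; case: (gf x).
have noise0 x i : \int[pi]_z (gradF x z - gradf x) ord0 i = 0.
  under eq_Rintegral do rewrite !mxE.
  have [iG EG] := intG x i.
  rewrite RintegralB//; last exact: bmeas_integrable (bmeas_cst _ _).
  by rewrite exp_cst /Rintegral -EG subrr.
have eta0 : 0 < eta by exact: lt_le_trans (eta_ge2 mu0 gamma0 mug).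
have p_eta : p <= eta.
  by apply: (le_trans p1); apply: le_trans (eta_ge2 mu0 gamma0 mug); rewrite ler1n.
have beta1 := beta_le1 p0 p1 mu0 gamma0 mug.
(* The empty prefix [[::]] imposes no constraint on the levels, so the bound concerns the whole of
   [Omega]. *)
have := @full_bound R dz Zsp dO Omega P Q pi Z J tau d f gradF gradf xs L mu sigma
  delta gamma p beta eta theta K M B l mZ mJ law piQ tau0 mix mgF mgf mf noise_le
  noise0 l0 lM lM1 B0 Lip scvx fmin L0 mu0 gamma0 u34 p0 eta0 p_eta beta0 beta1
  (eta_sqr mu0 gamma0) (beta3E p0 mu0 gamma0 mug) (beta_half p0 mu0 gamma0 mug)
  (thetaE_eta p0 p1 mu0 gamma0 mug) K0 hp hkap hkap1 x0
  (fun k => conj (fun i => (mtraj k i).1) (fun i => (mtraj k i).2)) N [::].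
rewrite cylJ0 big_nil mul1r => bound; apply: (le_trans bound).
rewrite lee_fin; set V := Rintegral _ _ _.
have -> : V = Psi0 by exact: (exp_cst P Psi0).
have h1 := ler_wpM2r Psi00 (contraction_le_exp p0 p1 mu0 gamma0 mug N).
have T0 : 0 <= 15 * (eta ^+ 2 * p * gamma ^+ 2 * (p * K * sigma ^+ 2)).
  by rewrite !mulr_ge0 ?sqr_ge0// ltW.
have h2 := le_trans (ler_wpM2l T0 (contraction_sum_le p0 p1 mu0 gamma0 mug N))
  (stationary_error p0 mu0 gamma0 K0 (sqr_ge0 sigma)).
have h3 : K * sigma ^+ 2 <= (c + 1) *
    (sigma ^+ 2 * tau%:R / b%:R + sigma ^+ 2 * tau%:R ^+ 2 / b%:R ^+ 2).
  have := mulr_ge0 (sqr_ge0 sigma) t1; rewrite KE.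
  rewrite -(mulrA _ tau%:R) -(mulrA _ (tau%:R ^+ 2)); lra.
have h4 := ler_wpM2l fac0 h3.
have h5 : 0 <= expR (- (N%:R * Num.sqrt (p ^+ 2 * mu * gamma / 3))) * Psi0.
  by rewrite mulr_ge0// expR_ge0.
have h6 : 1 <= 90 * (c + 1) by lra.
have h7 := ler_wpM2r h5 h6.
rewrite [leRHS]mulrDr; apply: lerD; first by rewrite mul1r in h7; exact: le_trans h1 h7.
apply: (le_trans h2); rewrite -[X in _ <= X]mulrA ler_wpM2l//.
by rewrite [leRHS]mulrCA.
Qed.
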